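(* Let $0<s\le1$, let $\lambda$ be a real number, and let $f(z)=z+\sum_{n=2}^{\infty}a_nz^n$ belong to $\mathcal{ST}_{hpl}(s)$. Then $$|a_3-\lambda a_2^2|\le\begin{cases}s^2\left(\lambda-\dfrac{3s+1}{4s}\right)&\text{for }\lambda\ge\dfrac{3s+3}{4s},\\[1em]\dfrac{s}{2}&\text{for }\dfrac{3s-1}{4s}\le\lambda\le\dfrac{3s+3}{4s},\\[1em]-s^2\left(\lambda-\dfrac{3s+1}{4s}\right)&\text{for }\lambda\le\dfrac{3s-1}{4s}.\end{cases}$$ The inequalities are sharp: for every $0<s\le1$ and every real $\lambda$, equality is attained by some $f\in\mathcal{ST}_{hpl}(s)$.
   Context: Let $\mathbb{D}=\{z\in\mathbb{C}:|z|<1\}$, and let $\mathcal{S}$ be the class of functions $f(z)=z+\sum_{n\ge2}a_nz^n$ that are holomorphic and univalent in $\mathbb{D}$. For $0<s\le1$ put $\mathfrak{q}_s(z)=(1-z)^{-s}=e^{-s\ln(1-z)}$, $z\in\mathbb{D}$, with the branch of the logarithm such that $\mathfrak{q}_s(0)=1$. For holomorphic functions $p,F$ in $\mathbb{D}$, $p\prec F$ (subordination) means that there is a holomorphic $\omega:\mathbb{D}\to\mathbb{D}$ with $\omega(0)=0$ and $p(z)=F(\omega(z))$ for all $z\in\mathbb{D}$. The class $\mathcal{ST}_{hpl}(s)$ consists of all $f\in\mathcal{S}$ with $\frac{zf'(z)}{f(z)}\prec\mathfrak{q}_s(z)$ in $\mathbb{D}$. *)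

(* Defs.v *)
From Stdlib Require Import Reals Lra.
From Coquelicot Require Import Coquelicot.
Open Scope R_scope.

Definition unit_disk (z : C) : Prop := Cmod z < 1.

Definition holomorphic_in_disk (f : C -> C) : Prop :=
  forall z : C, unit_disk z -> @ex_derive C_AbsRing C_NormedModule f z.

Definition univalent_in_disk (f : C -> C) : Prop :=
  forall z w : C, unit_disk z -> unit_disk w -> f z = f w -> z = w.

(* f(z) = z + a_2 z^2 + a_3 z^3 + ... throughout the disk. *)
Definition normalized_expansion (f : C -> C) (a : nat -> C) : Prop :=
  a 0%nat = RtoC 0 /\ a 1%nat = RtoC 1 /\
  forall z : C, unit_disk z -> @is_pseries C_AbsRing C_NormedModule a z (f z).

Definition class_S (f : C -> C) : Prop :=
  holomorphic_in_disk f /\ univalent_in_disk f /\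
  exists a : nat -> C, normalized_expansion f a.

Definition Cexp (z : C) : C :=
  (exp (Re z) * cos (Im z), exp (Re z) * sin (Im z)).

(* This is the principal logarithm only on the right half-plane 0 < Re w,
   which contains 1 - z for every z in the unit disk. *)
Definition Cln_right (w : C) : C := (ln (Cmod w), atan (Im w / Re w)).

Lemma Cexp_Cln_right (w : C) : 0 < Re w -> Cexp (Cln_right w) = w.
Proof.
destruct w as [x y]; intros Hx; unfold Cexp, Cln_right, Cmod; simpl in *.
assert (Hn : x * (x * 1) + y * (y * 1) = x * x * (1 + (y / x)²)).
{ unfold Rsqr; field; lra. }
assert (Hp : 0 < 1 + (y / x)²) by (pose proof (Rle_0_sqr (y / x)); lra).
assert (Hs : sqrt (1 + (y / x)²) <> 0).
{ apply Rgt_not_eq, sqrt_lt_R0, Hp. }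
assert (Hm : sqrt (x * (x * 1) + y * (y * 1)) = x * sqrt (1 + (y / x)²)).
{ rewrite Hn, sqrt_mult by nra; rewrite sqrt_square by lra; reflexivity. }
rewrite exp_ln, Hm, cos_atan, sin_atan.
- f_equal; field; try split; lra.
- rewrite Hm; apply Rmult_lt_0_compat; [lra | apply sqrt_lt_R0, Hp].
Qed.

Definition q_hpl (s : R) (z : C) : C :=
  Cexp (- RtoC s * Cln_right (1 - z))%C.

Lemma q_hpl_0 (s : R) : q_hpl s 0 = RtoC 1.
Proof.
unfold q_hpl, Cln_right.
replace (1 - 0)%C with (RtoC 1) by ring.
rewrite Cmod_1, ln_1; simpl.
replace (0 / 1) with 0 by field; rewrite atan_0.
replace (- RtoC s * (0, 0))%C with (RtoC 0)
  by (change (0, 0) with (RtoC 0); ring).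
unfold Cexp; simpl.
rewrite exp_0, cos_0, sin_0, Rmult_1_l, Rmult_0_r; reflexivity.
Qed.

Definition subordinate (p F : C -> C) : Prop :=
  exists omega : C -> C,
    holomorphic_in_disk omega /\
    (forall z : C, unit_disk z -> unit_disk (omega z)) /\
    omega 0 = RtoC 0 /\
    forall z : C, unit_disk z -> p z = F (omega z).

(* z f'(z) / f(z), with its removable singularity at 0 filled by the limit,
   which is 1 because f(0) = 0 and f'(0) = 1. *)
Definition zf'_over_f (f : C -> C) (z : C) : C :=
  if Ceq_dec z 0 then RtoC 1 else (z * C_derive f z / f z)%C.

Definition class_ST_hpl (s : R) (f : C -> C) : Prop :=
  class_S f /\ subordinate (zf'_over_f f) (q_hpl s).

(* Main.v *)
Require Import Defs.
From Stdlib Require Import Reals Lra Lia Psatz.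
From Coquelicot Require Import Coquelicot.
Open Scope R_scope.

(** Let p = z f'/f and write p = q_s(omega), where omega is a holomorphic
    self-map of the disk with omega(z) = c1 z + c2 z^2 + o(z^2). Since
    q_s(w) = 1 + s w + s(s+1)/2 w^2 + o(w^2), comparing coefficients in
    f' = (f/z) q_s(omega) gives a2 = s c1 and
    a3 = s/2 (c2 + (3s+1)/2 c1^2), hence
      a3 - lambda a2^2 = s/2 (c2 + mu c1^2),   mu = (3s+1)/2 - 2 s lambda
    ([starlike_schwarz_data]). The classical inequality |c2| <= 1 - |c1|^2
    ([schwarz_second_coeff]) bounds this by s/2 max(1, |mu|), and the three
    ranges of lambda are mu <= -1, |mu| <= 1 and mu >= 1.

    The inequality |c2| <= 1 - |c1|^2 says that the lower triangular Toeplitz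
    matrix with entries c1, c2 is a contraction, because multiplication by omega
    does not increase L^2 norms on circles. The inner products in that argument
    are means over |z| = r of functions holomorphic in the punctured disk, and
    these means do not depend on r. Independence is proved by differentiating
    under the integral sign ([circle_positivity]); this needs a continuous
    derivative of omega, which is read off from p' = q_s'(omega) omega', as p
    is a quotient of power series and q_s' has no zero.

    For sharpness, omega(z) = z gives c1 = 1, c2 = 0 and omega(z) = z^2 gives
    c1 = 0, c2 = 1, so that one of them attains s/2 max(1, |mu|). The function
    with z f'/f = 1 + z B(z) is f = z exp(Q), where Q' = B and Q(0) = 0. Its
    power series is constructed, not just its coefficients at 0: exp(Q) = sum
    h_n z^n with (n+1) h_{n+1} = sum_k beta_k h_{n-k}, where the beta_k are the
    coefficients of B; as |beta_k| <= 1, induction gives |h_n| <= 1, and the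
    Cauchy product turns the recursion into the differential equation of exp(Q)
    ([exp_primitive_series]). Univalence is seen in the coordinate u = log z on
    the left half-plane: L(u) = u + Q(e^u) has L' = z f'/f with positive real
    part, so L is injective on this convex domain, and L commutes with
    translation by 2 pi i ([univalent_of_log_derivative]). *)

(** * Continuity and differentiation of complex functions *)

(** Continuity with respect to the modulus; C also carries the product uniform
    structure, and this formulation is independent of that choice. *)
Definition Ccont (f : C -> C) (z : C) : Prop :=
  forall eps : R, 0 < eps -> exists delta : R, 0 < delta /\
    forall w : C, Cmod (w - z) < delta -> Cmod (f w - f z) < eps.

(** Complex differentiability in Carathéodory's form: the difference quotient
    extends continuously to z. The product and chain rules become algebraic
    identities, and a zero at z can be divided out with a continuous quotient. *)
Definition Cder (f : C -> C) (z l : C) : Prop :=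
  exists phi : C -> C, Ccont phi z /\ phi z = l /\
    forall w : C, f w = (f z + (w - z) * phi w)%C.

Lemma Cmod_sub_sym (z w : C) : Cmod (z - w) = Cmod (w - z).
Proof. rewrite <- Cmod_opp. f_equal. ring. Qed.

Lemma Cmod_triangle_inv (z w : C) : Cmod z - Cmod w <= Cmod (z - w).
Proof.
pose proof (Cmod_triangle (z - w) w) as H.
replace (z - w + w)%C with z in H by ring. lra.
Qed.

Lemma Ccont_const (c z : C) : Ccont (fun _ => c) z.
Proof.
intros eps He; exists 1; split; [lra|]; intros w _.
replace (c - c)%C with (RtoC 0) by ring. rewrite Cmod_0; lra.
Qed.

Lemma Ccont_id (z : C) : Ccont (fun w => w) z.
Proof. intros eps He; exists eps; split; auto. Qed.

Lemma Ccont_local (f g : C -> C) (z : C) (r : R) : 0 < r ->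
  (forall w, Cmod (w - z) < r -> f w = g w) -> Ccont f z -> Ccont g z.
Proof.
intros Hr Hfg Hf eps He. destruct (Hf eps He) as [d [Hd Hd']].
exists (Rmin d r); split; [apply Rmin_pos; auto|].
intros w Hw. rewrite <- !Hfg.
- apply Hd', Rlt_le_trans with (1 := Hw), Rmin_l.
- replace (z - z)%C with (RtoC 0) by ring. rewrite Cmod_0; lra.
- apply Rlt_le_trans with (1 := Hw), Rmin_r.
Qed.

Lemma Ccont_ext (f g : C -> C) (z : C) :
  (forall w, f w = g w) -> Ccont f z -> Ccont g z.
Proof. intros H; apply (Ccont_local f g z 1); auto; lra. Qed.

Lemma Ccont_plus (f g : C -> C) (z : C) :
  Ccont f z -> Ccont g z -> Ccont (fun w => f w + g w)%C z.
Proof.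
intros Hf Hg eps He.
destruct (Hf (eps / 2)) as [d [Hd Hd']]; [lra|].
destruct (Hg (eps / 2)) as [e [Hep Hep']]; [lra|].
exists (Rmin d e); split; [apply Rmin_pos; auto|]; intros w Hw.
replace (f w + g w - (f z + g z))%C with ((f w - f z) + (g w - g z))%C by ring.
eapply Rle_lt_trans; [apply Cmod_triangle|].
pose proof (Hd' w (Rlt_le_trans _ _ _ Hw (Rmin_l _ _))).
pose proof (Hep' w (Rlt_le_trans _ _ _ Hw (Rmin_r _ _))). lra.
Qed.

Lemma Ccont_mult (f g : C -> C) (z : C) :
  Ccont f z -> Ccont g z -> Ccont (fun w => f w * g w)%C z.
Proof.
intros Hf Hg eps He.
pose proof (Cmod_ge_0 (f z)) as Hfz; pose proof (Cmod_ge_0 (g z)) as Hgz.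
set (m := Cmod (f z) + Cmod (g z) + 1).
set (e := Rmin 1 (eps / (2 * m))).
assert (Hm : 0 < m) by (unfold m; lra).
assert (He0 : 0 < e).
{ apply Rmin_pos; [lra|]. apply Rdiv_lt_0_compat; lra. }
destruct (Hf e He0) as [d1 [Hd1 H1]]. destruct (Hg e He0) as [d2 [Hd2 H2]].
exists (Rmin d1 d2); split; [apply Rmin_pos; auto|]; intros w Hw.
specialize (H1 w (Rlt_le_trans _ _ _ Hw (Rmin_l _ _))).
specialize (H2 w (Rlt_le_trans _ _ _ Hw (Rmin_r _ _))).
replace (f w * g w - f z * g z)%C
  with ((f w - f z) * (g w - g z) + ((f w - f z) * g z + f z * (g w - g z)))%C by ring.
assert (Hb : Cmod ((f w - f z) * (g w - g z) + ((f w - f z) * g z + f z * (g w - g z)))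
  <= Cmod (f w - f z) * Cmod (g w - g z)
     + (Cmod (f w - f z) * Cmod (g z) + Cmod (f z) * Cmod (g w - g z))).
{ eapply Rle_trans; [apply Cmod_triangle|]. rewrite Cmod_mult.
  apply Rplus_le_compat_l. eapply Rle_trans; [apply Cmod_triangle|].
  rewrite !Cmod_mult; apply Rle_refl. }
pose proof (Cmod_ge_0 (f w - f z)); pose proof (Cmod_ge_0 (g w - g z)).
assert (He1 : e <= 1) by apply Rmin_l.
assert (He2 : e * (2 * m) <= eps).
{ apply Rle_trans with (eps / (2 * m) * (2 * m)).
  - apply Rmult_le_compat_r; [lra | apply Rmin_r].
  - right; field; lra. }
unfold m in *. nra.
Qed.

Lemma Ccont_opp (f : C -> C) (z : C) : Ccont f z -> Ccont (fun w => - f w)%C z.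
Proof.
intros Hf. apply (Ccont_ext (fun w => (-1) * f w)%C); [intros; ring|].
apply Ccont_mult; [apply Ccont_const | exact Hf].
Qed.

Lemma Ccont_minus (f g : C -> C) (z : C) :
  Ccont f z -> Ccont g z -> Ccont (fun w => f w - g w)%C z.
Proof. intros Hf Hg; apply Ccont_plus; [|apply Ccont_opp]; assumption. Qed.

Lemma Ccont_comp (f g : C -> C) (z : C) :
  Ccont f z -> Ccont g (f z) -> Ccont (fun w => g (f w)) z.
Proof.
intros Hf Hg eps He. destruct (Hg eps He) as [d [Hd Hd']].
destruct (Hf d Hd) as [e [Hep Hep']]. exists e; split; auto.
Qed.

Lemma Ccont_inv_at (z : C) : z <> 0 -> Ccont Cinv z.
Proof.
intros Hz eps He. pose proof (proj1 (Cmod_gt_0 z) Hz) as Hp.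
exists (Rmin (Cmod z / 2) (eps * (Cmod z * Cmod z) / 2)); split.
{ apply Rmin_pos; [lra|]. apply Rdiv_lt_0_compat; [|lra].
  repeat apply Rmult_lt_0_compat; assumption. }
intros w Hw.
pose proof (Rlt_le_trans _ _ _ Hw (Rmin_l _ _)) as H1.
pose proof (Rlt_le_trans _ _ _ Hw (Rmin_r _ _)) as H2.
pose proof (Cmod_triangle_inv z w) as H3. rewrite Cmod_sub_sym in H3.
assert (Hwp : Cmod z / 2 < Cmod w) by lra.
assert (Hw0 : w <> 0) by (apply Cmod_gt_0; lra).
replace (/ w - / z)%C with ((z - w) * / (w * z))%C by (field; split; assumption).
rewrite Cmod_mult, Cmod_inv, Cmod_mult, Cmod_sub_sym
  by (apply Cmult_neq_0; assumption).
apply Rmult_lt_reg_r with (Cmod w * Cmod z); [nra|].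
assert (Hwz : 0 < Cmod w * Cmod z) by nra.
rewrite Rmult_assoc, Rinv_l by lra.
assert (0 < eps * Cmod z * (Cmod w - Cmod z / 2))
  by (repeat apply Rmult_lt_0_compat; lra).
lra.
Qed.

Lemma Ccont_inv (f : C -> C) (z : C) :
  f z <> 0 -> Ccont f z -> Ccont (fun w => / f w)%C z.
Proof. intros H Hf. apply (Ccont_comp f Cinv); [|apply Ccont_inv_at]; assumption. Qed.

(** Limits are unique: this is how identities divided by z are extended to z = 0. *)
Lemma Ccont_eq_of_punctured (f g : C -> C) (z : C) (r : R) : 0 < r ->
  Ccont f z -> Ccont g z ->
  (forall w, w <> z -> Cmod (w - z) < r -> f w = g w) -> f z = g z.
Proof.
intros Hr Hf Hg H.
destruct (Ceq_dec (f z) (g z)) as [E|E]; [exact E|exfalso].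
assert (Hn : (f z - g z)%C <> 0).
{ intros H0; apply E. replace (f z) with (g z + (f z - g z))%C by ring.
  rewrite H0; ring. }
pose proof (proj1 (Cmod_gt_0 _) Hn) as Hp.
destruct (Ccont_minus f g z Hf Hg _ Hp) as [d [Hd Hd']].
set (t := Rmin d r / 2).
assert (Ht : 0 < t) by (unfold t; pose proof (Rmin_pos d r Hd Hr); lra).
assert (Htd : t < d) by (unfold t; pose proof (Rmin_l d r); lra).
assert (Htr : t < r) by (unfold t; pose proof (Rmin_r d r); lra).
assert (Hm : Cmod (z + t - z) = t).
{ replace (z + t - z)%C with (RtoC t) by ring. rewrite Cmod_R. apply Rabs_pos_eq; lra. }
specialize (Hd' (z + t)%C). rewrite Hm in Hd'. specialize (Hd' Htd).
rewrite (H (z + t)%C) in Hd'.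
- replace (g (z + t) - g (z + t) - (f z - g z))%C with (- (f z - g z))%C in Hd' by ring.
  rewrite Cmod_opp in Hd'; lra.
- intros E'. rewrite E' in Hm. replace (z - z)%C with (RtoC 0) in Hm by ring.
  rewrite Cmod_0 in Hm; lra.
- rewrite Hm; exact Htr.
Qed.

Lemma Cder_eps (f : C -> C) (z l : C) :
  (forall eps, 0 < eps -> exists delta, 0 < delta /\ forall w, Cmod (w - z) < delta ->
     Cmod (f w - f z - (w - z) * l) <= eps * Cmod (w - z)) -> Cder f z l.
Proof.
intros H.
exists (fun w => if Ceq_dec w z then l else (f w - f z) / (w - z))%C.
split; [|split].
- intros eps He. destruct (H (eps / 2)) as [d [Hd Hd']]; [lra|].
  exists d; split; [exact Hd|]; intros w Hw.
  destruct (Ceq_dec z z) as [_|n]; [|now contradiction n].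
  destruct (Ceq_dec w z) as [E|E].
  + replace (l - l)%C with (RtoC 0) by ring. rewrite Cmod_0; exact He.
  + assert (Hn : (w - z)%C <> 0).
    { intros H0; apply E. replace w with ((w - z) + z)%C by ring. rewrite H0; ring. }
    pose proof (proj1 (Cmod_gt_0 _) Hn) as Hp.
    replace ((f w - f z) / (w - z) - l)%C
      with ((f w - f z - (w - z) * l) / (w - z))%C by (field; exact Hn).
    rewrite Cmod_div by exact Hn.
    apply Rmult_lt_reg_r with (Cmod (w - z)); [exact Hp|].
    unfold Rdiv; rewrite Rmult_assoc, Rinv_l by lra.
    specialize (Hd' w Hw). nra.
- destruct (Ceq_dec z z) as [_|n]; [reflexivity|now contradiction n].
- intros w. destruct (Ceq_dec w z) as [E|E].
  + rewrite E; ring.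
  + field. intros H0; apply E. replace w with ((w - z) + z)%C by ring. rewrite H0; ring.
Qed.

Lemma Cder_is_derive (f : C -> C) (z l : C) :
  Cder f z l <-> @is_derive C_AbsRing C_NormedModule f z l.
Proof.
split.
- intros [phi [Hc [Hl Hf]]]. split; [apply (@is_linear_scal_l C_AbsRing C_NormedModule)|].
  intros x Hx. apply (@is_filter_lim_locally_unique C_AbsRing (AbsRing_NormedModule C_AbsRing)) in Hx; subst x.
  intros eps. destruct (Hc eps (cond_pos eps)) as [d [Hd Hd']].
  exists (mkposreal d Hd). intros w Hw.
  change (Cmod (w - z) < d) in Hw.
  change (Cmod (f w - f z - (w - z) * l) <= eps * Cmod (w - z)).
  rewrite (Hf w). replace (f z + (w - z) * phi w - f z - (w - z) * l)%C
    with ((phi w - phi z) * (w - z))%C by (rewrite Hl; ring).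
  rewrite Cmod_mult. apply Rmult_le_compat_r; [apply Cmod_ge_0|].
  left; apply Hd', Hw.
- intros [_ H]. apply Cder_eps. intros eps He.
  specialize (H z (fun P HP => HP) (mkposreal eps He)).
  destruct H as [d Hd]. exists d; split; [apply cond_pos|].
  intros w Hw. apply (Hd w). exact Hw.
Qed.

Lemma Cder_cont (f : C -> C) (z l : C) : Cder f z l -> Ccont f z.
Proof.
intros [phi [Hc [_ Hf]]].
apply (Ccont_ext (fun w => f z + (w - z) * phi w)%C); [intros; now rewrite <- Hf|].
apply Ccont_plus; [apply Ccont_const|].
apply Ccont_mult; [|exact Hc].
apply Ccont_minus; [apply Ccont_id | apply Ccont_const].
Qed.

Lemma Csub_neq (w z : C) : w <> z -> (w - z)%C <> 0.
Proof.
intros E H0; apply E. replace w with ((w - z) + z)%C by ring. rewrite H0; ring.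
Qed.

Lemma Cder_unique (f : C -> C) (z l m : C) : Cder f z l -> Cder f z m -> l = m.
Proof.
intros [phi [Hc [<- Hf]]] [psi [Hd [<- Hg]]].
apply (Ccont_eq_of_punctured phi psi z 1 Rlt_0_1 Hc Hd).
intros w Hw _. apply Csub_neq in Hw.
replace (phi w) with ((f z + (w - z) * phi w - f z) / (w - z))%C by (field; exact Hw).
rewrite <- Hf, (Hg w). field; exact Hw.
Qed.

Lemma Cder_eq (f : C -> C) (z l m : C) : Cder f z l -> l = m -> Cder f z m.
Proof. now intros H <-. Qed.

Lemma Cder_const (c z : C) : Cder (fun _ => c) z 0.
Proof.
exists (fun _ => RtoC 0); split; [apply Ccont_const|split; [reflexivity|]].
intros; ring.
Qed.

Lemma Cder_id (z : C) : Cder (fun w => w) z 1.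
Proof.
exists (fun _ => RtoC 1); split; [apply Ccont_const|split; [reflexivity|]].
intros; ring.
Qed.

Lemma Cder_plus (f g : C -> C) (z l m : C) :
  Cder f z l -> Cder g z m -> Cder (fun w => f w + g w)%C z (l + m).
Proof.
intros [phi [Hc [<- Hf]]] [psi [Hd [<- Hg]]].
exists (fun w => phi w + psi w)%C.
split; [apply Ccont_plus; assumption|split; [reflexivity|]].
intros w; rewrite (Hf w), (Hg w); ring.
Qed.

Lemma Cder_mult (f g : C -> C) (z l m : C) :
  Cder f z l -> Cder g z m -> Cder (fun w => f w * g w)%C z (l * g z + f z * m).
Proof.
intros Df Dg. pose proof (Cder_cont _ _ _ Dg) as Cg.
destruct Df as [phi [Hc [<- Hf]]], Dg as [psi [Hd [<- Hg]]].
exists (fun w => phi w * g w + f z * psi w)%C.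
split; [|split; [reflexivity|]].
- apply Ccont_plus; apply Ccont_mult; auto using Ccont_const.
- intros w; rewrite (Hf w). rewrite (Hg w) at 1 2. ring.
Qed.

Lemma Cder_comp (f g : C -> C) (z l m : C) :
  Cder f z l -> Cder g (f z) m -> Cder (fun w => g (f w)) z (m * l).
Proof.
intros Df Dg. pose proof (Cder_cont _ _ _ Df) as Cf.
destruct Df as [phi [Hc [<- Hf]]], Dg as [psi [Hd [<- Hg]]].
exists (fun w => psi (f w) * phi w)%C.
split; [|split; [reflexivity|]].
- apply Ccont_mult; [apply (Ccont_comp f psi)|]; assumption.
- intros w. rewrite (Hg (f w)), (Hf w) at 1. ring.
Qed.

Lemma Cder_local (f g : C -> C) (z l : C) (r : R) : 0 < r ->
  (forall w, Cmod (w - z) < r -> f w = g w) -> Cder f z l -> Cder g z l.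
Proof.
intros Hr Hfg [phi [Hc [Hl Hf]]]. apply Cder_eps. intros eps He.
destruct (Hc eps He) as [d [Hd Hd']].
exists (Rmin d r); split; [apply Rmin_pos; auto|]; intros w Hw.
rewrite <- !Hfg.
- rewrite (Hf w), <- Hl.
  replace (f z + (w - z) * phi w - f z - (w - z) * phi z)%C
    with ((phi w - phi z) * (w - z))%C by ring.
  rewrite Cmod_mult. apply Rmult_le_compat_r; [apply Cmod_ge_0|].
  left; apply Hd', Rlt_le_trans with (1 := Hw), Rmin_l.
- replace (z - z)%C with (RtoC 0) by ring. rewrite Cmod_0; lra.
- apply Rlt_le_trans with (1 := Hw), Rmin_r.
Qed.

Lemma Cder_ext (f g : C -> C) (z l : C) :
  (forall w, f w = g w) -> Cder f z l -> Cder g z l.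
Proof. intros H; apply (Cder_local f g z l 1); auto; lra. Qed.

(** The difference quotient of 1/w at z is - 1/(w z), continuous away from w = 0. *)
Lemma Cder_inv_at (z : C) : z <> 0 -> Cder Cinv z (- / (z * z)).
Proof.
intros Hz. apply Cder_eps. intros eps He.
assert (Hc : Ccont (fun w => - (/ w * / z))%C z).
{ apply Ccont_opp, Ccont_mult; [apply Ccont_inv_at, Hz | apply Ccont_const]. }
destruct (Hc eps He) as [d [Hd Hd']].
pose proof (proj1 (Cmod_gt_0 z) Hz) as Hp.
exists (Rmin d (Cmod z)); split; [apply Rmin_pos; auto|]; intros w Hw.
assert (Hw0 : w <> 0).
{ intros ->. pose proof (Rlt_le_trans _ _ _ Hw (Rmin_r _ _)) as H.
  rewrite Cmod_sub_sym in H. replace (z - 0)%C with z in H by ring. lra. }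
specialize (Hd' w (Rlt_le_trans _ _ _ Hw (Rmin_l _ _))).
replace (/ w - / z - (w - z) * - / (z * z))%C
  with ((- (/ w * / z) - - (/ z * / z)) * (w - z))%C by (field; split; assumption).
rewrite Cmod_mult. apply Rmult_le_compat_r; [apply Cmod_ge_0|lra].
Qed.

Lemma Cder_inv (f : C -> C) (z l : C) : f z <> 0 ->
  Cder f z l -> Cder (fun w => / f w)%C z (- l / (f z * f z)).
Proof.
intros Hz Hf. eapply Cder_eq.
- apply (Cder_comp f Cinv); [exact Hf | apply Cder_inv_at, Hz].
- field; exact Hz.
Qed.

(** * Complex series and power series in the unit disk *)

(** Convergence of the real and imaginary parts separately, which reduces
    statements on complex series to real ones. *)
Definition Cseries (u : nat -> C) (l : C) : Prop :=
  is_series (fun n => Re (u n)) (Re l) /\ is_series (fun n => Im (u n)) (Im l).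

Definition Csum (u : nat -> C) : C :=
  (Series (fun n => Re (u n)), Series (fun n => Im (u n))).

Lemma Im_le_Cmod (z : C) : Rabs (Im z) <= Cmod z.
Proof. eapply Rle_trans; [apply Rmax_r | apply (Rmax_Cmod z)]. Qed.

Lemma Cmod_le_Re_Im (z : C) : Cmod z <= Rabs (Re z) + Rabs (Im z).
Proof.
replace z with (RtoC (Re z) + Ci * RtoC (Im z))%C at 1
  by (destruct z; apply injective_projections; simpl; ring).
eapply Rle_trans; [apply Cmod_triangle|].
rewrite Cmod_mult, Cmod_Ci, !Cmod_R; lra.
Qed.

Lemma Ceq_Re_Im (z w : C) : Re z = Re w -> Im z = Im w -> z = w.
Proof. destruct z, w; simpl; intros -> ->; reflexivity. Qed.

Lemma Re_sum_n (u : nat -> C) (n : nat) :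
  Re (@sum_n C_AbelianMonoid u n) = sum_n (fun k => Re (u k)) n.
Proof.
induction n as [|n IH]; [now rewrite !sum_O|].
rewrite !sum_Sn, <- IH; reflexivity.
Qed.

Lemma Im_sum_n (u : nat -> C) (n : nat) :
  Im (@sum_n C_AbelianMonoid u n) = sum_n (fun k => Im (u k)) n.
Proof.
induction n as [|n IH]; [now rewrite !sum_O|].
rewrite !sum_Sn, <- IH; reflexivity.
Qed.

Lemma Cseries_is_series (u : nat -> C) (l : C) :
  Cseries u l <-> @is_series C_AbsRing C_NormedModule u l.
Proof.
unfold Cseries, is_series. split.
- intros [H1 H2] P [d Hd].
  specialize (H1 (fun x => Rabs (x - Re l) < d)).
  specialize (H2 (fun x => Rabs (x - Im l) < d)).
  destruct H1 as [N1 H1]; [exists d; intros y Hy; exact Hy|].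
  destruct H2 as [N2 H2]; [exists d; intros y Hy; exact Hy|].
  exists (max N1 N2). intros n Hn. apply Hd.
  specialize (H1 n ltac:(lia)); specialize (H2 n ltac:(lia)).
  rewrite <- Re_sum_n in H1. rewrite <- Im_sum_n in H2.
  split; [exact H1 | exact H2].
- intros H. split; intros P [d Hd].
  + destruct (H (fun z => P (Re z))) as [N HN].
    { exists d. intros y [Hy _]. apply Hd, Hy. }
    exists N; intros n Hn. rewrite <- Re_sum_n. apply HN, Hn.
  + destruct (H (fun z => P (Im z))) as [N HN].
    { exists d. intros y [_ Hy]. apply Hd, Hy. }
    exists N; intros n Hn. rewrite <- Im_sum_n. apply HN, Hn.
Qed.

Lemma Cseries_unique (u : nat -> C) (l m : C) : Cseries u l -> Cseries u m -> l = m.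
Proof.
intros [H1 H2] [H3 H4]. apply Ceq_Re_Im.
- apply is_series_unique in H1; apply is_series_unique in H3; congruence.
- apply is_series_unique in H2; apply is_series_unique in H4; congruence.
Qed.

Lemma Cseries_ext (u v : nat -> C) (l : C) :
  (forall n, u n = v n) -> Cseries u l -> Cseries v l.
Proof.
intros E [H1 H2]; split; [eapply is_series_ext; [|exact H1] | eapply is_series_ext; [|exact H2]];
  intros n; simpl; now rewrite E.
Qed.

Lemma Cseries_abs (u : nat -> C) :
  ex_series (fun n => Cmod (u n)) -> Cseries u (Csum u).
Proof.
intros H; split; apply Series_correct;
  (eapply (@ex_series_le R_AbsRing R_CompleteNormedModule); [|exact H]);
  intros n; [apply re_le_Cmod | apply Im_le_Cmod].
Qed.

(** The factor 2 comes from bounding the real and imaginary parts separately. *)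
Lemma Csum_le (u : nat -> C) (v : nat -> R) :
  (forall n, Cmod (u n) <= v n) -> ex_series v -> Cmod (Csum u) <= 2 * Series v.
Proof.
intros Hle Hv. eapply Rle_trans; [apply Cmod_le_Re_Im|].
assert (K : forall p : nat -> R, (forall n, Rabs (p n) <= v n) -> Rabs (Series p) <= Series v).
{ intros p Hp.
  assert (Ha : ex_series (fun n => Rabs (p n))).
  { eapply (@ex_series_le R_AbsRing R_CompleteNormedModule); [|exact Hv].
    intros n. change (Rabs (Rabs (p n)) <= v n). rewrite Rabs_Rabsolu. apply Hp. }
  eapply Rle_trans; [apply Series_Rabs, Ha|].
  apply Series_le; [|exact Hv]. intros n; split; [apply Rabs_pos | apply Hp]. }
unfold Csum; simpl.
pose proof (K (fun n => Re (u n)) (fun n => Rle_trans _ _ _ (re_le_Cmod _) (Hle n))).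
pose proof (K (fun n => Im (u n)) (fun n => Rle_trans _ _ _ (Im_le_Cmod _) (Hle n))).
simpl in *. lra.
Qed.

Lemma Cseries_plus (u v : nat -> C) (l m : C) :
  Cseries u l -> Cseries v m -> Cseries (fun n => u n + v n)%C (l + m).
Proof.
intros [H1 H2] [H3 H4]; split; simpl.
- apply (is_series_plus (fun n => Re (u n)) (fun n => Re (v n))); assumption.
- apply (is_series_plus (fun n => Im (u n)) (fun n => Im (v n))); assumption.
Qed.

Lemma Cseries_scal (c : C) (u : nat -> C) (l : C) :
  Cseries u l -> Cseries (fun n => c * u n)%C (c * l).
Proof.
rewrite !Cseries_is_series. apply (@is_series_scal C_AbsRing C_NormedModule).
Qed.

Lemma Cseries_minus (u v : nat -> C) (l m : C) :
  Cseries u l -> Cseries v m -> Cseries (fun n => u n - v n)%C (l - m).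
Proof.
intros H1 H2. apply (Cseries_scal (-1)) in H2.
replace (l - m)%C with (l + -1 * m)%C by ring.
apply (Cseries_ext (fun n => u n + -1 * v n)%C); [intros; ring|].
apply Cseries_plus; assumption.
Qed.

Lemma Cseries_shift (u : nat -> C) (l : C) :
  Cseries (fun n => u (S n)) l -> Cseries u (u 0%nat + l).
Proof.
rewrite !Cseries_is_series; intros H.
apply (@is_series_decr_1 C_AbsRing C_NormedModule).
refine (eq_ind l (fun m => @is_series C_AbsRing C_NormedModule _ m) H _ _).
change (l = u 0%nat + l + - u 0%nat)%C. ring.
Qed.

(** The real and imaginary parts of the Cauchy product are combinations of four
    Cauchy products of absolutely convergent real series. *)
Lemma Cseries_mult (u v : nat -> C) (l m : C) :
  ex_series (fun n => Cmod (u n)) -> ex_series (fun n => Cmod (v n)) ->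
  Cseries u l -> Cseries v m ->
  Cseries (fun n => @sum_n C_AbelianMonoid (fun k => u k * v (n - k)%nat)%C n) (l * m).
Proof.
assert (K : forall u : nat -> C, ex_series (fun n => Cmod (u n)) ->
  ex_series (fun n => Rabs (Re (u n))) /\ ex_series (fun n => Rabs (Im (u n)))).
{ intros w H; split; (eapply (@ex_series_le R_AbsRing R_CompleteNormedModule); [|exact H]);
  intros n; [change (Rabs (Rabs (Re (w n))) <= Cmod (w n))
            | change (Rabs (Rabs (Im (w n))) <= Cmod (w n))];
  rewrite Rabs_Rabsolu; [apply re_le_Cmod | apply Im_le_Cmod]. }
intros Hu Hv [H1 H2] [H3 H4].
destruct (K u Hu) as [A1 A2], (K v Hv) as [A3 A4].
pose proof (is_series_mult _ _ _ _ H1 H3 A1 A3) as P1.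
pose proof (is_series_mult _ _ _ _ H2 H4 A2 A4) as P2.
pose proof (is_series_mult _ _ _ _ H1 H4 A1 A4) as P3.
pose proof (is_series_mult _ _ _ _ H2 H3 A2 A3) as P4.
split.
- eapply is_series_ext; [|exact (is_series_minus _ _ _ _ P1 P2)].
  intros n. rewrite Re_sum_n, sum_n_Reals.
  change (@plus R_NormedModule) with Rplus; change (@opp R_NormedModule) with Ropp.
  simpl. rewrite minus_sum. reflexivity.
- eapply is_series_ext; [|exact (is_series_plus _ _ _ _ P3 P4)].
  intros n. rewrite Im_sum_n, sum_n_Reals.
  change (@plus R_NormedModule) with Rplus. simpl. rewrite sum_plus. reflexivity.
Qed.

Definition disk_conv (a : nat -> C) : Prop :=
  forall r : R, 0 <= r < 1 -> ex_series (fun n => Cmod (a n) * r ^ n).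

Definition CPS (a : nat -> C) (z : C) : C := Csum (fun n => a n * z ^ n)%C.

Definition CPS_derive (a : nat -> C) (n : nat) : C := (RtoC (INR (S n)) * a (S n))%C.

Lemma CV_radius_ge_1 (u : nat -> R) :
  (forall r, 0 <= r < 1 -> exists M, forall n, Rabs (u n * r ^ n) <= M) ->
  Rbar_le 1 (CV_radius u).
Proof.
intros H.
assert (K : forall r, 0 <= r < 1 -> Rbar_le r (CV_radius u)).
{ intros r Hr. apply (CV_radius_bounded u), H, Hr. }
destruct (CV_radius u) as [x| |]; simpl in *; auto.
- destruct (Rle_or_lt 1 x) as [Hx|Hx]; [exact Hx|exfalso].
  assert (0 <= x) by (apply (K 0); lra).
  specialize (K ((1 + x) / 2)). lra.
- apply (K 0). lra.
Qed.

Lemma disk_conv_radius (a : nat -> C) :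
  disk_conv a <-> Rbar_le 1 (CV_radius (fun n => Cmod (a n))).
Proof.
split.
- intros H. apply CV_radius_ge_1. intros r Hr.
  destruct (filterlim_bounded (fun n => Cmod (a n) * r ^ n)) as [M HM].
  + exists 0. apply (ex_series_lim_0 _ (H r Hr)).
  + exists M. exact HM.
- intros H r Hr.
  apply ex_series_ext with (fun n => Rabs (Cmod (a n) * r ^ n)).
  + intros n. apply Rabs_pos_eq, Rmult_le_pos; [apply Cmod_ge_0 | apply pow_le; lra].
  + apply CV_disk_inside. rewrite Rabs_pos_eq by lra.
    eapply Rbar_lt_le_trans; [|exact H]. simpl; lra.
Qed.

Lemma disk_conv_bounded (a : nat -> C) (M : R) :
  (forall n, Cmod (a n) <= M) -> disk_conv a.
Proof.
intros H r Hr.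
apply (@ex_series_le R_AbsRing R_CompleteNormedModule _ (fun n => M * r ^ n)).
- intros n. change (Rabs (Cmod (a n) * r ^ n) <= M * r ^ n).
  assert (0 <= r ^ n) by (apply pow_le; lra).
  rewrite Rabs_pos_eq; [|apply Rmult_le_pos; [apply Cmod_ge_0 | assumption]].
  apply Rmult_le_compat_r; auto.
- apply (ex_series_scal_l M (fun n => r ^ n)), ex_series_geom.
  rewrite Rabs_pos_eq; lra.
Qed.

Lemma disk_conv_derive (a : nat -> C) : disk_conv a -> disk_conv (CPS_derive a).
Proof.
rewrite !disk_conv_radius. intros H.
rewrite <- CV_radius_derive in H.
rewrite (CV_radius_ext _ (PS_derive (fun n => Cmod (a n)))); [exact H|].
intros n. unfold CPS_derive, PS_derive. rewrite Cmod_mult, Cmod_R.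
now rewrite (Rabs_pos_eq (INR (S n))) by apply pos_INR.
Qed.

Lemma disk_conv_shift (a : nat -> C) : disk_conv a -> disk_conv (fun n => a (S n)).
Proof.
rewrite !disk_conv_radius. intros H. rewrite <- CV_radius_decr_1 in H. exact H.
Qed.

Lemma CPS_abs (a : nat -> C) (z : C) : disk_conv a -> Cmod z < 1 ->
  ex_series (fun n => Cmod (a n * z ^ n)).
Proof.
intros H Hz. apply ex_series_ext with (fun n => Cmod (a n) * Cmod z ^ n).
- intros n; now rewrite Cmod_mult, Cmod_pow.
- apply H. split; [apply Cmod_ge_0 | exact Hz].
Qed.

Lemma CPS_correct (a : nat -> C) (z : C) : disk_conv a -> Cmod z < 1 ->
  Cseries (fun n => a n * z ^ n)%C (CPS a z).
Proof. intros H Hz. apply Cseries_abs, CPS_abs; assumption. Qed.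

Lemma pow_n_Cpow (z : C) (n : nat) : @pow_n C_Ring z n = (z ^ n)%C.
Proof. induction n as [|n IH]; [reflexivity|]. simpl. now rewrite IH. Qed.

Lemma is_pseries_Cseries (a : nat -> C) (z l : C) :
  @is_pseries C_AbsRing C_NormedModule a z l <-> Cseries (fun n => a n * z ^ n)%C l.
Proof.
assert (E : forall n, scal (@pow_n C_Ring z n) (a n) = (a n * z ^ n)%C).
{ intros n. rewrite pow_n_Cpow. apply Cmult_comm. }
rewrite Cseries_is_series. unfold is_pseries. split; apply is_series_ext; intros n.
- apply E.
- symmetry; apply E.
Qed.

Lemma pseries_disk_conv (a : nat -> C) (f : C -> C) :
  (forall z, unit_disk z -> @is_pseries C_AbsRing C_NormedModule a z (f z)) -> disk_conv a.
Proof.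
intros H. apply disk_conv_radius, CV_radius_ge_1. intros r Hr.
assert (Hu : unit_disk (RtoC r)) by (unfold unit_disk; rewrite Cmod_R, Rabs_pos_eq; lra).
apply H, is_pseries_Cseries in Hu. destruct Hu as [H1 H2].
destruct (filterlim_bounded (fun n => Re (a n * RtoC r ^ n))) as [M1 HM1].
{ exists 0. refine (ex_series_lim_0 _ _). eexists; exact H1. }
destruct (filterlim_bounded (fun n => Im (a n * RtoC r ^ n))) as [M2 HM2].
{ exists 0. refine (ex_series_lim_0 _ _). eexists; exact H2. }
exists (M1 + M2). intros n.
replace (Rabs (Cmod (a n) * r ^ n)) with (Cmod (a n * RtoC r ^ n)).
- eapply Rle_trans; [apply Cmod_le_Re_Im|]. apply Rplus_le_compat; [apply HM1 | apply HM2].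
- rewrite Cmod_mult, Cmod_pow, Cmod_R, (Rabs_pos_eq r) by lra.
  symmetry; apply Rabs_pos_eq, Rmult_le_pos; [apply Cmod_ge_0 | apply pow_le; lra].
Qed.

Lemma pseries_eq_CPS (a : nat -> C) (f : C -> C) (z : C) :
  (forall z, unit_disk z -> @is_pseries C_AbsRing C_NormedModule a z (f z)) ->
  Cmod z < 1 -> f z = CPS a z.
Proof.
intros H Hz. eapply Cseries_unique.
- apply is_pseries_Cseries, H, Hz.
- apply CPS_correct; [|exact Hz]. apply (pseries_disk_conv a f H).
Qed.

Lemma CPS_shift (a : nat -> C) (z : C) : disk_conv a -> Cmod z < 1 ->
  CPS a z = (a 0%nat + z * CPS (fun n => a (S n)) z)%C.
Proof.
intros H Hz. eapply Cseries_unique; [apply CPS_correct; assumption|].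
replace (a 0%nat) with (a 0%nat * z ^ 0)%C by (simpl; ring).
apply (Cseries_shift (fun n => a n * z ^ n)%C).
apply (Cseries_ext (fun n => z * (a (S n) * z ^ n))%C); [intros n; simpl; ring|].
apply Cseries_scal, (CPS_correct (fun n => a (S n))); [|exact Hz].
apply disk_conv_shift, H.
Qed.

Lemma CPS_0 (a : nat -> C) : disk_conv a -> CPS a 0 = a 0%nat.
Proof. intros H. rewrite CPS_shift; [ring|exact H|]. rewrite Cmod_0; lra. Qed.

(** The second order Taylor remainder of w^(n+1) at z. It is multiplied by r, so
    that r^n appears instead of r^(n-1) and n = 0 is not a special case. *)
Lemma pow_taylor_bound (z w : C) (r : R) (n : nat) : 0 < r -> Cmod z <= r -> Cmod w <= r ->
  Cmod (w ^ S n - z ^ S n - (w - z) * (RtoC (INR (S n)) * z ^ n)) * r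
  <= INR n * INR (S n) * r ^ n * Cmod (w - z) ^ 2.
Proof.
intros Hr Hz Hw. induction n as [|n IH].
- simpl. replace (w * 1 - z * 1 - (w - z) * (1 * 1))%C with (RtoC 0) by ring.
  rewrite Cmod_0; lra.
- replace (w ^ S (S n) - z ^ S (S n) - (w - z) * (RtoC (INR (S (S n))) * z ^ S n))%C
    with (w * (w ^ S n - z ^ S n - (w - z) * (RtoC (INR (S n)) * z ^ n))
          + RtoC (INR (S n)) * z ^ n * (w - z) ^ 2)%C
    by (rewrite (S_INR (S n)), RtoC_plus; simpl Cpow; ring).
  set (E := (w ^ S n - z ^ S n - (w - z) * (RtoC (INR (S n)) * z ^ n))%C) in *.
  assert (Hle : Cmod (w * E + RtoC (INR (S n)) * z ^ n * (w - z) ^ 2)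
    <= r * Cmod E + INR (S n) * r ^ n * Cmod (w - z) ^ 2).
  { eapply Rle_trans; [apply Cmod_triangle|]. rewrite !Cmod_mult, !Cmod_pow, Cmod_R.
    rewrite (Rabs_pos_eq (INR (S n))) by apply pos_INR.
    apply Rplus_le_compat.
    - apply Rmult_le_compat_r; [apply Cmod_ge_0 | exact Hw].
    - apply Rmult_le_compat_r; [apply pow_le, Cmod_ge_0|].
      apply Rmult_le_compat_l; [apply pos_INR|]. apply pow_incr.
      split; [apply Cmod_ge_0 | exact Hz]. }
  eapply Rle_trans; [apply Rmult_le_compat_r; [lra | exact Hle]|].
  rewrite (S_INR (S n)). set (D := Cmod (w - z) ^ 2) in *.
  assert (HD : 0 <= D) by (apply pow_le, Cmod_ge_0).
  assert (HP : 0 <= r ^ n * D) by (apply Rmult_le_pos; [apply pow_le; lra | exact HD]).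
  pose proof (pos_INR n) as Hn. rewrite S_INR in *. simpl pow in *.
  apply Rle_trans with (r * (INR n * (INR n + 1) * r ^ n * D) + (INR n + 1) * r ^ n * D * r).
  + assert (r * (Cmod E * r) <= r * (INR n * (INR n + 1) * r ^ n * D))
      by (apply Rmult_le_compat_l; lra). lra.
  + assert (0 <= (INR n + 1) * (r ^ n * D) * r).
    { apply Rmult_le_pos; [apply Rmult_le_pos|]; lra. }
    lra.
Qed.

(** Termwise differentiation. By the preceding bound, the error is at most
    |w - z|^2 times the sum of n (n+1) |a_(n+1)| r^(n-1) for some r < 1, which
    converges since differentiation preserves the radius of convergence. *)
Lemma CPS_Cder (a : nat -> C) (z : C) : disk_conv a -> Cmod z < 1 ->
  Cder (CPS a) z (CPS (CPS_derive a) z).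
Proof.
intros Ha Hz. pose proof (Cmod_ge_0 z) as Hz0.
set (r := (1 + Cmod z) / 2). assert (Hr : Cmod z < r < 1) by (unfold r; lra).
assert (Hs : ex_series (fun n => INR n * Cmod (CPS_derive a n) * r ^ n)).
{ pose proof (disk_conv_derive _ (disk_conv_derive _ Ha) r ltac:(lra)) as H.
  apply ex_series_incr_1.
  apply (ex_series_ext (fun n => r * (Cmod (CPS_derive (CPS_derive a) n) * r ^ n))).
  - intros n. unfold CPS_derive at 1. rewrite Cmod_mult, Cmod_R.
    rewrite (Rabs_pos_eq (INR (S n))) by apply pos_INR. simpl pow.
    match goal with |- ?x = ?y => change (@eq R x y) end. ring.
  - apply (ex_series_scal_l r (fun n => Cmod (CPS_derive (CPS_derive a) n) * r ^ n)), H. }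
set (M := 2 * Series (fun n => INR n * Cmod (CPS_derive a n) * r ^ n)).
assert (HM : 0 <= M).
{ apply Rmult_le_pos; [lra|].
  set (v := fun n => INR n * Cmod (CPS_derive a n) * r ^ n) in *.
  rewrite <- (Rmult_0_l (Series v)), <- Series_scal_l. apply Series_le; [|exact Hs].
  intros n; split; [lra|]. unfold v. rewrite Rmult_0_l. apply Rmult_le_pos; [apply Rmult_le_pos|];
   [apply pos_INR | apply Cmod_ge_0 | apply pow_le; lra]. }
apply Cder_eps. intros eps He.
exists (Rmin (r - Cmod z) (eps * r / (M + 1))); split.
{ apply Rmin_pos; [lra|]. apply Rdiv_lt_0_compat; [apply Rmult_lt_0_compat|]; lra. }
intros w Hw. pose proof (Rlt_le_trans _ _ _ Hw (Rmin_l _ _)) as Hw1.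
pose proof (Rlt_le_trans _ _ _ Hw (Rmin_r _ _)) as Hw2.
pose proof (Cmod_triangle_inv w z) as Ht.
assert (Hwr : Cmod w <= r) by lra.
assert (Hw' : Cmod w < 1) by lra.
set (E := fun n => (a (S n) * (w ^ S n - z ^ S n - (w - z) * (RtoC (INR (S n)) * z ^ n)))%C).
assert (HE : (CPS a w - CPS a z - (w - z) * CPS (CPS_derive a) z)%C = Csum E).
{ assert (Hbw := CPS_correct _ w Ha Hw'). assert (Hbz := CPS_correct _ z Ha Hz).
  assert (Hd := CPS_correct _ z (disk_conv_derive _ Ha) Hz).
  rewrite (CPS_shift a w Ha Hw'), (CPS_shift a z Ha Hz).
  pose proof (CPS_correct _ w (disk_conv_shift _ Ha) Hw') as Sw.
  pose proof (CPS_correct _ z (disk_conv_shift _ Ha) Hz) as Sz.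
  apply (Cseries_scal w) in Sw. apply (Cseries_scal z) in Sz.
  apply (Cseries_scal (w - z)%C) in Hd.
  pose proof (Cseries_minus _ _ _ _ (Cseries_minus _ _ _ _ Sw Sz) Hd) as T.
  assert (T' : Csum E = (w * CPS (fun n => a (S n)) w - z * CPS (fun n => a (S n)) z
      - (w - z) * CPS (CPS_derive a) z)%C).
  { assert (T0 : Cseries E (w * CPS (fun n => a (S n)) w - z * CPS (fun n => a (S n)) z
      - (w - z) * CPS (CPS_derive a) z)%C).
    { eapply Cseries_ext; [|exact T]. intros n; unfold E, CPS_derive; simpl Cpow;  ring. }
    destruct T0 as [T1 T2]. apply is_series_unique in T1; apply is_series_unique in T2.
    unfold Csum. rewrite T1, T2. symmetry. apply surjective_pairing. }
  rewrite T'. ring. }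
rewrite HE.
set (D := Cmod (w - z)). assert (HD : 0 <= D) by apply Cmod_ge_0.
assert (HEn : forall n, Cmod (E n) <= D ^ 2 / r * (INR n * Cmod (CPS_derive a n) * r ^ n)).
{ intros n. unfold E. rewrite Cmod_mult.
  apply Rmult_le_reg_r with r; [lra|].
  replace (D ^ 2 / r * (INR n * Cmod (CPS_derive a n) * r ^ n) * r)
    with (Cmod (a (S n)) * (INR n * INR (S n) * r ^ n * D ^ 2)).
  - rewrite Rmult_assoc. apply Rmult_le_compat_l; [apply Cmod_ge_0|].
    apply pow_taylor_bound; lra.
  - unfold CPS_derive. rewrite Cmod_mult, Cmod_R.
    rewrite (Rabs_pos_eq (INR (S n))) by apply pos_INR. field; lra. }
apply Csum_le in HEn; [|apply (ex_series_scal_l (D ^ 2 / r) (fun n => INR n * Cmod (CPS_derive a n) * r ^ n)), Hs].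
eapply Rle_trans; [exact HEn|]. rewrite Series_scal_l.
replace (2 * (D ^ 2 / r * Series (fun n => INR n * Cmod (CPS_derive a n) * r ^ n)))
  with (D * (D * M) / r) by (unfold M; field; lra).
apply Rmult_le_reg_r with r; [lra|].
replace (D * (D * M) / r * r) with (D * (D * M)) by (field; lra).
assert (D * (M + 1) <= eps * r).
{ apply Rle_trans with (eps * r / (M + 1) * (M + 1)).
  - apply Rmult_le_compat_r; [lra|]. fold D in Hw2. lra.
  - right; field; lra. }
assert (D * (D * (M + 1)) <= D * (eps * r)) by (apply Rmult_le_compat_l; lra).
assert (0 <= D * D) by nra. lra.
Qed.

Lemma CPS_cont (a : nat -> C) (z : C) : disk_conv a -> Cmod z < 1 -> Ccont (CPS a) z.
Proof. intros Ha Hz. eapply Cder_cont, CPS_Cder; assumption. Qed.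

Lemma CPS_mult (a b : nat -> C) (z : C) : disk_conv a -> disk_conv b -> Cmod z < 1 ->
  Cseries (fun n => @sum_n C_AbelianMonoid (fun k => a k * b (n - k)%nat)%C n * z ^ n)%C
    (CPS a z * CPS b z).
Proof.
intros Ha Hb Hz.
eapply Cseries_ext; [|apply Cseries_mult; [apply (CPS_abs a z) | apply (CPS_abs b z)
  | apply (CPS_correct a z) | apply (CPS_correct b z)]; assumption].
intros n. rewrite Cmult_comm.
rewrite <- (@sum_n_mult_l C_Ring). apply sum_n_ext_loc. intros k Hk.
change (a k * z ^ k * (b (n - k)%nat * z ^ (n - k)) = z ^ n * (a k * b (n - k)%nat))%C.
replace n with (k + (n - k))%nat at 3 by lia. rewrite Cpow_add_r. ring.
Qed.

(** * The exponential, the logarithm and the function q_s *)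

Lemma Cexp_plus (z w : C) : Cexp (z + w) = (Cexp z * Cexp w)%C.
Proof.
destruct z, w; unfold Cexp; apply Ceq_Re_Im; simpl; rewrite exp_plus, ?cos_plus, ?sin_plus; ring.
Qed.

Lemma Cexp_0 : Cexp 0 = 1.
Proof. unfold Cexp; simpl. rewrite exp_0, cos_0, sin_0. apply Ceq_Re_Im; simpl; ring. Qed.

Lemma Cmod_Cexp (z : C) : Cmod (Cexp z) = exp (Re z).
Proof.
unfold Cexp, Cmod; simpl fst; simpl snd.
replace ((exp (Re z) * cos (Im z)) ^ 2 + (exp (Re z) * sin (Im z)) ^ 2)
  with (exp (Re z) * exp (Re z)).
- apply sqrt_square. left; apply exp_pos.
- pose proof (sin2_cos2 (Im z)) as H. unfold Rsqr in H. nra.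
Qed.

Lemma Cexp_neq_0 (z : C) : Cexp z <> 0.
Proof. apply Cmod_gt_0. rewrite Cmod_Cexp. apply exp_pos. Qed.

Lemma derivable_pt_lim_bound (f : R -> R) (x l eps : R) : derivable_pt_lim f x l ->
  0 < eps -> exists d, 0 < d /\ forall h, Rabs h < d -> Rabs (f (x + h) - f x - l * h) <= eps * Rabs h.
Proof.
intros H He. destruct (H eps He) as [[d Hd] Hd']. exists d; split; [exact Hd|].
intros h Hh. destruct (Req_dec h 0) as [->|Hn].
- rewrite Rplus_0_r. replace (f x - f x - l * 0) with 0 by ring. rewrite Rabs_R0; lra.
- specialize (Hd' h Hn Hh).
  replace (f (x + h) - f x - l * h) with (((f (x + h) - f x) / h - l) * h) by (field; exact Hn).
  rewrite Rabs_mult. apply Rmult_le_compat_r; [apply Rabs_pos | lra].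
Qed.

Lemma Cder_Cexp_0 : Cder Cexp 0 1.
Proof.
apply Cder_eps. intros eps He.
set (e := Rmin 1 (eps / 9)).
assert (He0 : 0 < e) by (apply Rmin_pos; lra).
assert (He1 : e <= 1) by apply Rmin_l. assert (He2 : e <= eps / 9) by apply Rmin_r.
destruct (derivable_pt_lim_bound _ _ _ e (derivable_pt_lim_exp 0) He0) as [d1 [Hd1 H1]].
destruct (derivable_pt_lim_bound _ _ _ e (derivable_pt_lim_cos 0) He0) as [d2 [Hd2 H2]].
destruct (derivable_pt_lim_bound _ _ _ e (derivable_pt_lim_sin 0) He0) as [d3 [Hd3 H3]].
exists (Rmin (Rmin e d1) (Rmin d2 d3)). split; [repeat first [assumption | apply Rmin_pos]|].
intros [x y] Hw. rewrite Cexp_0.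
replace ((x, y) - 0)%C with ((x, y) : C) in * by (apply Ceq_Re_Im; simpl; ring).
pose proof (Rlt_le_trans _ _ _ Hw (Rmin_l _ _)) as Hwa.
pose proof (Rlt_le_trans _ _ _ Hw (Rmin_r _ _)) as Hwb.
pose proof (Rlt_le_trans _ _ _ Hwa (Rmin_l _ _)) as Hw0.
pose proof (Rlt_le_trans _ _ _ Hwa (Rmin_r _ _)) as Hw1.
pose proof (Rlt_le_trans _ _ _ Hwb (Rmin_l _ _)) as Hw2.
pose proof (Rlt_le_trans _ _ _ Hwb (Rmin_r _ _)) as Hw3.
pose proof (re_le_Cmod (x, y)) as Hx; pose proof (Im_le_Cmod (x, y)) as Hy. simpl in Hx, Hy.
set (m := Cmod (x, y)) in *.
specialize (H1 x ltac:(lra)); specialize (H2 y ltac:(lra)); specialize (H3 y ltac:(lra)).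
rewrite Rplus_0_l, exp_0 in H1. rewrite Rplus_0_l, cos_0, sin_0 in H2.
rewrite Rplus_0_l, cos_0, sin_0 in H3.
set (E := exp x - 1 - 1 * x) in *. set (Kc := cos y - 1 - - 0 * y) in *.
set (S := sin y - 0 - 1 * y) in *.
assert (HEm : Rabs E <= e * m) by nra. assert (HKm : Rabs Kc <= e * m) by nra.
assert (HSm : Rabs S <= e * m) by nra.
eapply Rle_trans; [apply Cmod_le_Re_Im|].
unfold Cexp; simpl.
replace (exp x * cos y + - (1) + - (x * 1 - y * 0)) with (E + (1 + x + E) * Kc)
  by (unfold E, Kc; ring).
replace (exp x * sin y + - 0 + - (x * 0 + y * 1)) with (S + (x + E) * (y + S))
  by (unfold E, S; ring).
assert (A : forall p q a b : R, Rabs p <= a -> Rabs q <= b -> Rabs (p * q) <= a * b).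
{ intros p q a b Hp Hq. rewrite Rabs_mult. apply Rmult_le_compat; auto using Rabs_pos. }
assert (B : forall p q a b : R, Rabs p <= a -> Rabs q <= b -> Rabs (p + q) <= a + b).
{ intros p q a b Hp Hq. eapply Rle_trans; [apply Rabs_triang | lra]. }
assert (Hm : 0 <= m) by (apply Rle_trans with (2 := Hx), Rabs_pos).
assert (H1E : Rabs (1 + x + E) <= 1 + m + e * m).
{ apply B; [apply B|]; try assumption. rewrite Rabs_R1; lra. }
assert (HxE : Rabs (x + E) <= m + e * m) by (apply B; assumption).
assert (HyS : Rabs (y + S) <= m + e * m) by (apply B; assumption).
pose proof (B _ _ _ _ HEm (A _ _ _ _ H1E HKm)).
pose proof (B _ _ _ _ HSm (A _ _ _ _ HxE HyS)).
set (q := e * m) in *.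
assert (Hq0 : 0 <= q) by (unfold q; nra). assert (Hqm : q <= m) by (unfold q; nra).
assert (Hmq : m * m <= q) by (unfold q; nra). assert (Hqe : 9 * q <= eps * m) by (unfold q; nra).
assert ((1 + m + q) * q <= 3 * q) by nra.
assert ((m + q) * (m + q) <= (2 * m) * (2 * m)) by (apply Rmult_le_compat; lra).
lra.
Qed.

Lemma Cder_Cexp (z : C) : Cder Cexp z (Cexp z).
Proof.
apply (Cder_ext (fun w => Cexp z * Cexp (w - z))%C).
{ intros w. rewrite <- Cexp_plus. f_equal. ring. }
eapply Cder_eq.
- apply Cder_mult; [apply Cder_const|].
  apply (Cder_comp (fun w => w - z)%C).
  + apply (Cder_plus (fun w => w) (fun _ => - z)%C); [apply Cder_id | apply Cder_const].
  + replace (z - z)%C with (RtoC 0) by ring. apply Cder_Cexp_0.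
- cbv beta. ring.
Qed.

Lemma Ccont_components (u v : C -> R) (z : C) :
  (forall eps, 0 < eps -> exists d, 0 < d /\ forall w, Cmod (w - z) < d -> Rabs (u w - u z) < eps) ->
  (forall eps, 0 < eps -> exists d, 0 < d /\ forall w, Cmod (w - z) < d -> Rabs (v w - v z) < eps) ->
  Ccont (fun w => (u w, v w)) z.
Proof.
intros Hu Hv eps He.
destruct (Hu (eps / 2)) as [d1 [Hd1 H1]]; [lra|].
destruct (Hv (eps / 2)) as [d2 [Hd2 H2]]; [lra|].
exists (Rmin d1 d2); split; [apply Rmin_pos; assumption|]; intros w Hw.
specialize (H1 w (Rlt_le_trans _ _ _ Hw (Rmin_l _ _))).
specialize (H2 w (Rlt_le_trans _ _ _ Hw (Rmin_r _ _))).
eapply Rle_lt_trans; [apply Cmod_le_Re_Im|]. unfold Rminus in *. simpl. lra.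
Qed.

Lemma continuity_pt_eps (f : R -> R) (x eps : R) : continuity_pt f x -> 0 < eps ->
  exists d, 0 < d /\ forall y, Rabs (y - x) < d -> Rabs (f y - f x) < eps.
Proof.
intros H He. destruct (H eps He) as [d [Hd H']]. exists d; split; [exact Hd|].
intros y Hy. destruct (Req_dec x y) as [<-|Hn].
- replace (f x - f x) with 0 by ring. rewrite Rabs_R0; exact He.
- apply H'. split; [split; [exact I | exact Hn] | exact Hy].
Qed.

Lemma Ccont_Cln_right (w : C) : 0 < Re w -> Ccont Cln_right w.
Proof.
intros Hw. assert (Hm : 0 < Cmod w).
{ eapply Rlt_le_trans; [exact Hw|]. eapply Rle_trans; [|apply re_le_Cmod]. apply Rle_abs. }
apply Ccont_components.
- intros eps He.
  assert (Hc : continuity_pt ln (Cmod w)).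
  { apply derivable_continuous_pt. exists (/ Cmod w). apply derivable_pt_lim_ln, Hm. }
  destruct (continuity_pt_eps _ _ eps Hc He) as [d [Hd H]].
  exists d; split; [exact Hd|]. intros z Hz. apply H.
  eapply Rle_lt_trans; [|exact Hz]. apply Rabs_le.
  pose proof (Cmod_triangle_inv z w). pose proof (Cmod_triangle_inv w z).
  rewrite (Cmod_sub_sym w z) in *. lra.
- intros eps He.
  assert (Hc : continuity_pt atan (Im w / Re w)).
  { apply derivable_continuous_pt. eexists. apply derivable_pt_lim_atan. }
  destruct (continuity_pt_eps _ _ eps Hc He) as [d [Hd H]].
  assert (Hq : Ccont (fun z => RtoC (Im z) / RtoC (Re z))%C w).
  { apply Ccont_mult; [|apply Ccont_inv].
    - intros e Hep. exists e; split; [exact Hep|]. intros z Hz.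
      eapply Rle_lt_trans; [|exact Hz]. rewrite <- RtoC_minus, Cmod_R. apply (Im_le_Cmod (z - w)).
    - intros E. apply RtoC_inj in E. lra.
    - intros e Hep. exists e; split; [exact Hep|]. intros z Hz.
      eapply Rle_lt_trans; [|exact Hz]. rewrite <- RtoC_minus, Cmod_R. apply (re_le_Cmod (z - w)). }
  destruct (Hq d Hd) as [d' [Hd' H']].
  exists (Rmin d' (Re w)); split; [apply Rmin_pos; assumption|]. intros z Hz. apply H.
  specialize (H' z (Rlt_le_trans _ _ _ Hz (Rmin_l _ _))).
  pose proof (Rlt_le_trans _ _ _ Hz (Rmin_r _ _)) as Hz2.
  pose proof (re_le_Cmod (z - w)) as Hz3. simpl in Hz3.
  assert (Hzp : 0 < fst z).
  { apply Rle_lt_trans with (2 := Hz2) in Hz3. apply Rabs_def2 in Hz3. unfold Re in *. lra. }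
  rewrite <- (RtoC_div (Im z)), <- (RtoC_div (Im w)), <- RtoC_minus, Cmod_R in H'
    by (unfold Re in *; lra).
  exact H'.
Qed.

(** Inverse function rule: the continuous difference quotient of the exponential
    at the logarithm of w is nonzero near w and can be inverted. *)
Lemma Cder_Cln_right (w : C) : 0 < Re w -> Cder Cln_right w (/ w).
Proof.
intros Hw. pose proof (Ccont_Cln_right w Hw) as Hc.
assert (Hw0 : w <> 0) by (intros ->; simpl in Hw; lra).
destruct (Cder_Cexp (Cln_right w)) as [phi [Hp [Hp0 Hphi]]].
rewrite Cexp_Cln_right in Hp0 by exact Hw.
assert (Hcp : Ccont (fun z => phi (Cln_right z)) w) by (apply (Ccont_comp Cln_right phi); assumption).
assert (Hci : Ccont (fun z => / phi (Cln_right z))%C w).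
{ apply Ccont_inv; [rewrite Hp0; exact Hw0 | exact Hcp]. }
apply Cder_eps. intros eps He. destruct (Hci eps He) as [d [Hd H]].
assert (Hwm : 0 < Cmod w) by (apply Cmod_gt_0, Hw0).
destruct (Hcp (Cmod w) Hwm) as [d1 [Hd1 H1]].
exists (Rmin d (Rmin d1 (Re w))); split; [repeat first [assumption | apply Rmin_pos]|].
intros z Hz. specialize (H z (Rlt_le_trans _ _ _ Hz (Rmin_l _ _))).
pose proof (Rlt_le_trans _ _ _ Hz (Rmin_r _ _)) as Hz'.
specialize (H1 z (Rlt_le_trans _ _ _ Hz' (Rmin_l _ _))).
pose proof (Rlt_le_trans _ _ _ Hz' (Rmin_r _ _)) as Hz2.
pose proof (re_le_Cmod (z - w)) as Hz3. simpl in Hz3.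
assert (Hzp : 0 < Re z).
{ apply Rle_lt_trans with (2 := Hz2) in Hz3. apply Rabs_def2 in Hz3. unfold Re in *. lra. }
specialize (Hphi (Cln_right z)). rewrite !Cexp_Cln_right in Hphi by assumption.
rewrite Hp0 in H1, H.
assert (Hn : phi (Cln_right z) <> 0).
{ intros E. rewrite E in H1. replace (0 - w)%C with (- w)%C in H1 by ring.
  rewrite Cmod_opp in H1. lra. }
assert (Hzw : (z - w)%C = ((Cln_right z - Cln_right w) * phi (Cln_right z))%C)
  by (rewrite Hphi at 1; ring).
replace (Cln_right z - Cln_right w)%C with ((z - w) * / phi (Cln_right z))%C
  by (rewrite Hzw; field; exact Hn).
replace ((z - w) * / phi (Cln_right z) - (z - w) * / w)%C
  with ((/ phi (Cln_right z) - / w) * (z - w))%C by ring.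
rewrite Cmod_mult. apply Rmult_le_compat_r; [apply Cmod_ge_0 | lra].
Qed.

Lemma Re_one_minus_pos (w : C) : Cmod w < 1 -> 0 < Re (1 - w).
Proof.
intros H. pose proof (Rle_lt_trans _ _ _ (re_le_Cmod w) H) as K.
apply Rabs_def2 in K. destruct w; simpl in *. lra.
Qed.

Lemma one_minus_neq_0 (w : C) : Cmod w < 1 -> (1 - w)%C <> 0.
Proof. intros H E. apply Re_one_minus_pos in H. rewrite E in H. simpl in H. lra. Qed.

Lemma Cder_one_minus (w : C) : Cder (fun v => 1 - v)%C w (-1).
Proof.
apply (Cder_ext (fun v => 1 + -1 * v)%C); [intros; ring|].
eapply Cder_eq.
- apply Cder_plus; [apply Cder_const|]. apply Cder_mult; [apply Cder_const | apply Cder_id].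
- cbv beta. ring.
Qed.

Lemma Cder_q_hpl (s : R) (w : C) : Cmod w < 1 ->
  Cder (q_hpl s) w (RtoC s * q_hpl s w / (1 - w)).
Proof.
intros Hw. eapply Cder_eq.
- apply (Cder_comp (fun v => - RtoC s * Cln_right (1 - v))%C Cexp); [|apply Cder_Cexp].
  apply Cder_mult; [apply Cder_const|].
  apply (Cder_comp (fun v => 1 - v)%C Cln_right).
  + apply Cder_one_minus.
  + apply Cder_Cln_right, Re_one_minus_pos, Hw.
- unfold q_hpl. field. apply one_minus_neq_0, Hw.
Qed.

Lemma q_hpl_neq_0 (s : R) (w : C) : q_hpl s w <> 0.
Proof. apply Cexp_neq_0. Qed.

(** The argument of (1 - w)^(-s) is less than s pi/2 in modulus, at most pi/2. *)
Lemma Re_q_hpl_pos (s : R) (w : C) : 0 < s <= 1 -> 0 < Re (q_hpl s w).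
Proof.
intros Hs. unfold q_hpl, Cexp, Cln_right.
set (x := ln (Cmod (1 - w))). set (t := atan (Im (1 - w) / Re (1 - w))).
apply Rmult_lt_0_compat; [apply exp_pos|].
pose proof (atan_bound (Im (1 - w) / Re (1 - w))) as Ht. fold t in Ht.
replace (Im (- RtoC s * (x, t))) with (- (s * t)) by (simpl; ring).
rewrite cos_neg. apply cos_gt_0; nra.
Qed.

(** One of z, - z, i z, - i z lies in the right half-plane, where the logarithm is
    available, and - 1 and i are exponentials. *)
Lemma polar_form (z : C) : z <> 0 -> exists u : C, z = Cexp u.
Proof.
intros Hz.
assert (HP : Cexp (0, PI) = -1).
{ unfold Cexp; simpl. rewrite exp_0, cos_PI, sin_PI. apply Ceq_Re_Im; simpl; ring. }
assert (HI : Cexp (0, PI / 2) = Ci).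
{ unfold Cexp; simpl. rewrite exp_0, cos_PI2, sin_PI2. apply Ceq_Re_Im; simpl; ring. }
assert (K : forall v, 0 < Re v -> exists u, v = Cexp u).
{ intros v Hv; exists (Cln_right v). symmetry; apply Cexp_Cln_right, Hv. }
assert (KI : forall v, (exists u, v = Cexp u) -> exists u, (Ci * v)%C = Cexp u).
{ intros v [u ->]. exists (((0, PI / 2)%R : C) + u)%C. now rewrite Cexp_plus, HI. }
assert (KP : forall v, (exists u, v = Cexp u) -> exists u, (-1 * v)%C = Cexp u).
{ intros v [u ->]. exists (((0, PI)%R : C) + u)%C. now rewrite Cexp_plus, HP. }
destruct (Rtotal_order (Re z) 0) as [H|[H|H]].
- replace z with (-1 * (- z))%C by ring. apply KP, K. destruct z; simpl in *; lra.
- destruct (Rtotal_order (Im z) 0) as [H'|[H'|H']].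
  + replace z with (-1 * (Ci * (Ci * z)))%C
      by (apply Ceq_Re_Im; destruct z; simpl; ring).
    apply KP, KI, K. destruct z; simpl in *; lra.
  + exfalso; apply Hz. apply Ceq_Re_Im; [exact H | exact H'].
  + replace z with (Ci * (-1 * (Ci * z)))%C
      by (apply Ceq_Re_Im; destruct z; simpl; ring).
    apply KI, K. destruct z; simpl in *; lra.
- apply K, H.
Qed.

Lemma Cexp_eq_1 (z : C) : Cexp z = 1 -> exists k : Z, z = (0, 2 * IZR k * PI).
Proof.
intros H.
assert (Hx : Re z = 0).
{ apply exp_inv. rewrite <- Cmod_Cexp, H, Cmod_1, exp_0. reflexivity. }
assert (Hc : cos (Im z) = 1).
{ apply (f_equal Re) in H. unfold Cexp in H; simpl in H.
  change (fst z) with (Re z) in H. rewrite Hx, exp_0 in H. simpl in H. unfold Im in *; lra. }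
assert (Hs : sin (Im z / 2) = 0).
{ replace (Im z) with (2 * (Im z / 2)) in Hc by field. rewrite cos_2a_sin in Hc. nra. }
apply sin_eq_0_0 in Hs. destruct Hs as [k Hk]. exists k.
apply Ceq_Re_Im; [exact Hx|]. change (Im z = 2 * IZR k * PI). lra.
Qed.

Lemma Cexp_period (k : Z) : Cexp (0, 2 * IZR k * PI) = 1.
Proof.
assert (Hs : sin (IZR k * PI) = 0) by (apply sin_eq_0_1; exists k; reflexivity).
unfold Cexp; simpl. rewrite exp_0.
replace (2 * IZR k * PI) with (2 * (IZR k * PI)) by ring.
rewrite cos_2a_sin, sin_2a, Hs. apply Ceq_Re_Im; simpl; ring.
Qed.

(** * Circle means of holomorphic functions *)

(** Real paths such as segments, rays and circles extend to holomorphic functions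
    of a complex parameter. With this lemma and the next one, derivatives along
    such paths are computed with the complex chain rule alone. *)
Lemma continuous_Re_of_Ccont (F : C -> C) (x : R) : Ccont F (RtoC x) ->
  continuous (fun t : R => Re (F (RtoC t))) x.
Proof.
intros H P [d Hd]. destruct (H d (cond_pos d)) as [e [He H']].
exists (mkposreal e He). intros y Hy. apply Hd.
change (Rabs (y - x) < e) in Hy. change (Rabs (Re (F (RtoC y)) - Re (F (RtoC x))) < d).
specialize (H' (RtoC y)). rewrite <- RtoC_minus, Cmod_R in H'.
eapply Rle_lt_trans; [|exact (H' Hy)]. apply (re_le_Cmod (F (RtoC y) - F (RtoC x))).
Qed.

Lemma is_derive_Re_of_Cder (F : C -> C) (x : R) (l : C) : Cder F (RtoC x) l ->
  is_derive (fun t : R => Re (F (RtoC t))) x (Re l).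
Proof.
intros [phi [Hc [<- HF]]]. apply is_derive_Reals. intros eps He.
destruct (Hc eps He) as [d [Hd H]]. exists (mkposreal d Hd). intros h Hh Hhd.
simpl in Hhd. specialize (H (RtoC (x + h))).
assert (E : (RtoC (x + h) - RtoC x)%C = RtoC h) by (rewrite RtoC_plus; ring).
rewrite E, Cmod_R in H. specialize (H Hhd).
replace (Re (F (RtoC (x + h)))) with (Re (F (RtoC x)) + h * Re (phi (RtoC (x + h)))).
- replace ((Re (F (RtoC x)) + h * Re (phi (RtoC (x + h))) - Re (F (RtoC x))) / h - Re (phi (RtoC x)))
    with (Re (phi (RtoC (x + h)) - phi (RtoC x))) by (unfold Cminus; simpl; unfold Re; field; exact Hh).
  eapply Rle_lt_trans; [apply re_le_Cmod | exact H].
- rewrite (HF (RtoC (x + h))), E. simpl. unfold Re; ring.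
Qed.

Definition circ (t : C) : C := Cexp (Ci * t).

Lemma Cder_circ (t : C) : Cder circ t (Ci * circ t).
Proof.
eapply Cder_eq.
- apply (Cder_comp (fun t => Ci * t)%C Cexp); [|apply Cder_Cexp].
  apply Cder_mult; [apply Cder_const | apply Cder_id].
- unfold circ. cbv beta. ring.
Qed.

Lemma Cmod_circ (t : R) : Cmod (circ (RtoC t)) = 1.
Proof.
unfold circ. rewrite Cmod_Cexp.
replace (Re (Ci * RtoC t)) with 0 by (simpl; ring). apply exp_0.
Qed.

Lemma circ_neq_0 (t : C) : circ t <> 0.
Proof. apply Cexp_neq_0. Qed.

Lemma circ_2PI : circ (RtoC (2 * PI)) = circ 0.
Proof.
unfold circ. replace (Ci * 0)%C with (RtoC 0) by ring. rewrite Cexp_0.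
replace (Ci * RtoC (2 * PI))%C with ((0, 2 * IZR 1 * PI) : C)
  by (apply Ceq_Re_Im; simpl; ring).
apply Cexp_period.
Qed.

Lemma Cmod_on_circle (r t : R) : 0 <= r -> Cmod (RtoC r * circ (RtoC t)) = r.
Proof. intros Hr. rewrite Cmod_mult, Cmod_circ, Cmod_R, Rabs_pos_eq; lra. Qed.

Lemma on_circle_neq_0 (r t : R) : 0 < r -> (RtoC r * circ (RtoC t))%C <> 0.
Proof. intros Hr. apply Cmod_gt_0. rewrite Cmod_on_circle; lra. Qed.

(** Holomorphic in the punctured disk, with continuous derivative; the continuity
    allows differentiation of circle means under the integral sign. *)
Definition C1hol (G : C -> C) : Prop :=
  exists G' : C -> C, forall z : C, z <> 0 -> Cmod z < 1 -> Cder G z (G' z) /\ Ccont G' z.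

Lemma punctured_ball (z : C) : z <> 0 -> Cmod z < 1 ->
  exists r, 0 < r /\ forall w, Cmod (w - z) < r -> w <> 0 /\ Cmod w < 1.
Proof.
intros H0 H1. apply Cmod_gt_0 in H0.
exists (Rmin (Cmod z) (1 - Cmod z)). split; [apply Rmin_pos; lra|].
intros w Hw. pose proof (Rlt_le_trans _ _ _ Hw (Rmin_l _ _)).
pose proof (Rlt_le_trans _ _ _ Hw (Rmin_r _ _)).
pose proof (Cmod_triangle_inv w z). pose proof (Cmod_triangle_inv z w).
rewrite (Cmod_sub_sym z w) in *. split; [apply Cmod_gt_0|]; lra.
Qed.

Lemma C1hol_ext (F G : C -> C) : (forall z : C, z <> 0 -> Cmod z < 1 -> F z = G z) ->
  C1hol F -> C1hol G.
Proof.
intros E [F' HF]. exists F'. intros z H0 H1. split; [|apply HF; assumption].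
destruct (punctured_ball z H0 H1) as [r [Hr Hb]].
apply (Cder_local F G z _ r Hr); [|apply HF; assumption].
intros w Hw. apply E; apply Hb, Hw.
Qed.

Lemma C1hol_const (c : C) : C1hol (fun _ => c).
Proof. exists (fun _ => RtoC 0). intros; split; [apply Cder_const | apply Ccont_const]. Qed.

Lemma C1hol_id : C1hol (fun z => z).
Proof. exists (fun _ => RtoC 1). intros; split; [apply Cder_id | apply Ccont_const]. Qed.

Lemma C1hol_plus (F G : C -> C) : C1hol F -> C1hol G -> C1hol (fun z => F z + G z)%C.
Proof.
intros [F' HF] [G' HG]. exists (fun z => F' z + G' z)%C. intros z H0 H1.
destruct (HF z H0 H1), (HG z H0 H1). split; [apply Cder_plus | apply Ccont_plus]; assumption.
Qed.

Lemma C1hol_mult (F G : C -> C) : C1hol F -> C1hol G -> C1hol (fun z => F z * G z)%C.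
Proof.
intros [F' HF] [G' HG]. exists (fun z => F' z * G z + F z * G' z)%C. intros z H0 H1.
destruct (HF z H0 H1) as [DF CF], (HG z H0 H1) as [DG CG].
split; [apply Cder_mult; assumption|].
apply Ccont_plus; apply Ccont_mult; try assumption; eapply Cder_cont; eassumption.
Qed.

Lemma C1hol_minus (F G : C -> C) : C1hol F -> C1hol G -> C1hol (fun z => F z - G z)%C.
Proof.
intros HF HG. apply (C1hol_ext (fun z => F z + -1 * G z)%C); [intros; ring|].
apply C1hol_plus; [exact HF|]. apply C1hol_mult; [apply C1hol_const | exact HG].
Qed.

Lemma C1hol_inv (F : C -> C) : (forall z : C, z <> 0 -> Cmod z < 1 -> F z <> 0) ->
  C1hol F -> C1hol (fun z => / F z)%C.
Proof.
intros Hn [F' HF]. exists (fun z => - F' z * / (F z * F z))%C. intros z H0 H1.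
destruct (HF z H0 H1) as [DF CF]. specialize (Hn z H0 H1).
pose proof (Cder_cont _ _ _ DF).
split; [apply Cder_inv; assumption|].
apply Ccont_mult; [apply Ccont_opp, CF|].
apply Ccont_inv; [apply Cmult_neq_0; assumption | apply Ccont_mult; assumption].
Qed.

Section CircleMean.
Variables (G G' : C -> C).
Hypothesis HG : forall z : C, z <> 0 -> Cmod z < 1 -> Cder G z (G' z) /\ Ccont G' z.

Definition circle_integral (r : R) : R :=
  RInt (fun t => Re (G (RtoC r * circ (RtoC t)))) 0 (2 * PI).

Lemma is_derive_Re_radial (r t : R) : 0 < r < 1 ->
  is_derive (fun u : R => Re (G (RtoC u * circ (RtoC t)))) r
    (Re (G' (RtoC r * circ (RtoC t)) * (RtoC r * circ (RtoC t))) * / r).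
Proof.
intros Hr.
destruct (HG (RtoC r * circ (RtoC t))) as [D _].
{ apply on_circle_neq_0; lra. } { rewrite Cmod_on_circle; lra. }
replace (Re (G' (RtoC r * circ (RtoC t)) * (RtoC r * circ (RtoC t))) * / r)
  with (Re (G' (RtoC r * circ (RtoC t)) * circ (RtoC t))).
- apply (is_derive_Re_of_Cder (fun u => G (u * circ (RtoC t)))%C).
  eapply Cder_eq.
  + apply (Cder_comp (fun u => u * circ (RtoC t))%C G); [|exact D].
    apply (Cder_mult (fun u => u) (fun _ => circ (RtoC t))); [apply Cder_id | apply Cder_const].
  + cbv beta. ring.
- replace (G' (RtoC r * circ (RtoC t)) * (RtoC r * circ (RtoC t)))%C
    with (RtoC r * (G' (RtoC r * circ (RtoC t)) * circ (RtoC t)))%C by ring.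
  set (v := (G' (RtoC r * circ (RtoC t)) * circ (RtoC t))%C).
  replace (Re (RtoC r * v)) with (r * Re v) by (simpl; unfold Re; ring).
  field; lra.
Qed.

Lemma Cder_angular (r t : R) : 0 < r < 1 ->
  Cder (fun u => G (RtoC r * circ u)) (RtoC t)
    (Ci * (G' (RtoC r * circ (RtoC t)) * (RtoC r * circ (RtoC t)))).
Proof.
intros Hr.
destruct (HG (RtoC r * circ (RtoC t))) as [D _].
{ apply on_circle_neq_0; lra. } { rewrite Cmod_on_circle; lra. }
eapply Cder_eq.
- apply (Cder_comp (fun u => RtoC r * circ u)%C G); [|exact D].
  apply Cder_mult; [apply Cder_const | apply Cder_circ].
- cbv beta. ring.
Qed.

Lemma continuous_on_circle (r t : R) : 0 < r < 1 ->
  continuous (fun t : R => Re (G (RtoC r * circ (RtoC t)))) t.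
Proof.
intros Hr. apply (continuous_Re_of_Ccont (fun u => G (RtoC r * circ u))).
eapply Cder_cont, Cder_angular, Hr.
Qed.

Lemma ex_RInt_circle (r : R) : 0 < r < 1 ->
  ex_RInt (fun t => Re (G (RtoC r * circ (RtoC t)))) 0 (2 * PI).
Proof.
intros Hr. apply (@ex_RInt_continuous R_CompleteNormedModule).
intros t _. apply continuous_on_circle, Hr.
Qed.

Lemma continuity_2d_polar (K : C -> C) (r t : R) :
  Ccont K (RtoC r * circ (RtoC t))%C ->
  continuity_2d_pt (fun u v => Re (K (RtoC u * circ (RtoC v))%C)) r t.
Proof.
intros H eps. destruct (H eps (cond_pos eps)) as [d [Hd H']].
assert (Hc : Ccont (fun u => RtoC r * circ u)%C (RtoC t)).
{ apply Ccont_mult; [apply Ccont_const|]. eapply Cder_cont, Cder_circ. }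
destruct (Hc (d / 2)) as [e [He Hc']]; [lra|].
assert (Hm : 0 < Rmin e (d / 2)) by (apply Rmin_pos; lra).
exists (mkposreal _ Hm). simpl. intros u v Hu Hv.
eapply Rle_lt_trans; [apply (re_le_Cmod (_ - _))|]. apply H'.
replace (RtoC u * circ (RtoC v) - RtoC r * circ (RtoC t))%C
  with ((RtoC u - RtoC r) * circ (RtoC v) + (RtoC r * circ (RtoC v) - RtoC r * circ (RtoC t)))%C
  by ring.
eapply Rle_lt_trans; [apply Cmod_triangle|].
rewrite Cmod_mult, Cmod_circ, <- RtoC_minus, Cmod_R.
specialize (Hc' (RtoC v)). rewrite <- RtoC_minus, Cmod_R in Hc'.
specialize (Hc' (Rlt_le_trans _ _ _ Hv (Rmin_l _ _))).
pose proof (Rlt_le_trans _ _ _ Hu (Rmin_r _ _)). lra.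
Qed.

(** With z = r e^(it), the radial derivative of Re G is Re (z G'(z)) / r, while the
    derivative in t of Re (- i G) is Re (z G'(z)). So the derivative of the mean
    is the integral of a t-derivative over a full period. *)
Lemma is_derive_circle_integral (r : R) : 0 < r < 1 -> is_derive circle_integral r 0.
Proof.
intros Hr.
assert (Hloc : locally r (fun u : R => 0 < u < 1)).
{ assert (Hm : 0 < Rmin r (1 - r)) by (apply Rmin_pos; lra).
  exists (mkposreal _ Hm). intros u Hu. change (Rabs (u - r) < Rmin r (1 - r)) in Hu.
  pose proof (Rlt_le_trans _ _ _ Hu (Rmin_l _ _)) as A.
  pose proof (Rlt_le_trans _ _ _ Hu (Rmin_r _ _)) as B.
  apply Rabs_def2 in A; apply Rabs_def2 in B. lra. }
set (K := fun z => (G' z * z)%C).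
assert (HK : forall t, Ccont K (RtoC r * circ (RtoC t))).
{ intros t. apply Ccont_mult; [|apply Ccont_id].
  apply HG; [apply on_circle_neq_0; lra | rewrite Cmod_on_circle; lra]. }
assert (E : RInt (fun t => Derive (fun u : R => Re (G (RtoC u * circ (RtoC t)))) r) 0 (2 * PI) = 0).
{ rewrite (RInt_ext _ (fun t => scal (/ r) (Re (K (RtoC r * circ (RtoC t))%C)))).
  2:{ intros t _. rewrite (is_derive_unique _ _ _ (is_derive_Re_radial r t Hr)). unfold K.
      rewrite Rmult_comm. reflexivity. }
  apply is_RInt_unique.
  replace 0 with (scal (/ r) 0) at 2 by (apply Rmult_0_r).
  apply (@is_RInt_scal R_NormedModule).
  replace 0 with (minus (Re (- Ci * G (RtoC r * circ (RtoC (2 * PI)))))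
      (Re (- Ci * G (RtoC r * circ (RtoC 0))))) at 2
    by (rewrite circ_2PI; apply (@minus_eq_zero R_AbelianGroup)).
  apply (@is_RInt_derive R_CompleteNormedModule (fun t : R => Re (- Ci * G (RtoC r * circ (RtoC t))))).
  - intros t _. apply (is_derive_Re_of_Cder (fun u => - Ci * G (RtoC r * circ u))%C).
    eapply Cder_eq.
    + apply Cder_mult; [apply Cder_const | apply Cder_angular, Hr].
    + unfold K. cbv beta. 
      replace (- Ci * (Ci * (G' (RtoC r * circ (RtoC t)) * (RtoC r * circ (RtoC t)))))%C
        with (- (Ci * Ci) * (G' (RtoC r * circ (RtoC t)) * (RtoC r * circ (RtoC t))))%C by ring.
      replace (- (Ci * Ci))%C with (RtoC 1) by (apply Ceq_Re_Im; simpl; ring). ring.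
  - intros t _. apply (continuous_Re_of_Ccont (fun u => K (RtoC r * circ u)%C)%C).
    apply (Ccont_comp (fun u => RtoC r * circ u)%C K); [|apply HK].
    apply Ccont_mult; [apply Ccont_const|]. eapply Cder_cont, Cder_circ. }
rewrite <- E.
apply (is_derive_RInt_param (fun u t => Re (G (RtoC u * circ (RtoC t))))).
- apply (filter_imp (fun u : R => 0 < u < 1)); [|exact Hloc].
  intros u Hu t _. eexists. apply is_derive_Re_radial, Hu.
- intros t _.
  apply (continuity_2d_pt_ext_loc (fun u v => Re (K (RtoC u * circ (RtoC v))%C) * / u)).
  + destruct Hloc as [d Hd]. exists d. intros u v Hu _.
    symmetry. apply is_derive_unique, is_derive_Re_radial. apply Hd, Hu.
  + apply continuity_2d_pt_mult; [apply continuity_2d_polar, HK|].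
    apply continuity_2d_pt_inv; [apply continuity_2d_pt_id1 | lra].
- apply (filter_imp (fun u : R => 0 < u < 1)); [|exact Hloc].
  intros u Hu. apply ex_RInt_circle, Hu.
Qed.

Lemma circle_integral_const (r1 r2 : R) : 0 < r1 < r2 -> r2 < 1 ->
  circle_integral r1 = circle_integral r2.
Proof.
intros H1 H2. apply eq_is_derive; [|lra].
intros r Hr. apply is_derive_circle_integral. lra.
Qed.
End CircleMean.

(** The mean of Re R0 over |z| = r equals Re (R0 0), as seen by letting r tend to 0,
    and the polar term c / z has mean 0. *)
Lemma circle_positivity (H R0 : C -> C) (c : C) (r : R) : 0 < r < 1 -> C1hol H ->
  (forall z : C, z <> 0 -> Cmod z < 1 -> H z = (c / z + R0 z)%C) -> Ccont R0 0 ->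
  (forall z : C, Cmod z = r -> 0 <= Re (H z)) -> 0 <= Re (R0 0).
Proof.
intros Hr HC HE Hc0 Hpos. destruct (Rle_or_lt 0 (Re (R0 0))) as [|Hneg]; [assumption|exfalso].
assert (HR : C1hol R0).
{ apply (C1hol_ext (fun z => H z - c * / z)%C).
  { intros z H0 H1. rewrite HE by assumption. unfold Cdiv; ring. }
  apply C1hol_minus; [exact HC|]. apply C1hol_mult; [apply C1hol_const|].
  apply C1hol_inv; [auto | apply C1hol_id]. }
destruct HR as [R' HR].
pose proof PI_RGT_0 as HPI.
destruct (Hc0 (- Re (R0 0) / 2)) as [d [Hd Hd']]; [lra|].
set (q := Rmin d r / 2).
assert (Hq : 0 < q) by (unfold q; pose proof (Rmin_pos d r Hd (proj1 Hr)); lra).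
assert (Hqd : q < d) by (unfold q; pose proof (Rmin_l d r); lra).
assert (Hqr : q < r) by (unfold q; pose proof (Rmin_r d r); lra).
pose proof (circle_integral_const R0 R' HR q r (conj Hq Hqr) (proj2 Hr)) as Heq.
assert (Hsmall : circle_integral R0 q < 0).
{ apply Rle_lt_trans with (RInt (fun _ => Re (R0 0) / 2) 0 (2 * PI)).
  - apply RInt_le; [lra | apply (ex_RInt_circle R0 R' HR); lra | apply ex_RInt_const|].
    intros t _. specialize (Hd' (RtoC q * circ (RtoC t))%C).
    replace (RtoC q * circ (RtoC t) - 0)%C with (RtoC q * circ (RtoC t))%C in Hd' by ring.
    rewrite Cmod_on_circle in Hd' by lra. specialize (Hd' Hqd).
    pose proof (Rle_lt_trans _ _ _ (re_le_Cmod _) Hd') as K. apply Rabs_def2 in K.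
    simpl in K. unfold Re in *. lra.
  - rewrite RInt_const. change (scal (2 * PI - 0) (Re (R0 0) / 2)) with ((2 * PI - 0) * (Re (R0 0) / 2)).
    nra. }
assert (Hbig : 0 <= circle_integral R0 r).
{ assert (I1 := RInt_correct _ _ _ (ex_RInt_circle R0 R' HR r Hr)).
  fold (circle_integral R0 r) in I1.
  assert (I2 : is_RInt (fun t => Re (c / (RtoC r * circ (RtoC t)))) 0 (2 * PI) 0).
  { set (A := fun u => (Ci * c / RtoC r * / circ u)%C).
    replace 0 with (minus (Re (A (RtoC (2 * PI)))) (Re (A (RtoC 0)))) at 2
      by (unfold A; rewrite circ_2PI; apply (@minus_eq_zero R_AbelianGroup)).
    assert (HA : forall t : R, Cder A (RtoC t) (c / (RtoC r * circ (RtoC t)))).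
    { intros t. eapply Cder_eq.
      - apply Cder_mult; [apply Cder_const|].
        apply Cder_inv; [apply circ_neq_0 | apply Cder_circ].
      - cbv beta. unfold A. pose proof (circ_neq_0 (RtoC t)).
        assert (RtoC r <> 0) by (intros E; apply RtoC_inj in E; lra).
        replace (0 * / circ (RtoC t) + Ci * c / RtoC r * (- (Ci * circ (RtoC t)) / (circ (RtoC t) * circ (RtoC t))))%C
          with (- (Ci * Ci) * (c / (RtoC r * circ (RtoC t))))%C by (field; auto).
        replace (- (Ci * Ci))%C with (RtoC 1) by (apply Ceq_Re_Im; simpl; ring). ring. }
    apply (@is_RInt_derive R_CompleteNormedModule (fun t : R => Re (A (RtoC t)))).
    - intros t _. apply is_derive_Re_of_Cder, HA.
    - intros t _. apply (continuous_Re_of_Ccont (fun u => c / (RtoC r * circ u))%C).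
      apply Ccont_mult; [apply Ccont_const|]. apply Ccont_inv.
      + apply on_circle_neq_0; lra.
      + apply Ccont_mult; [apply Ccont_const|]. eapply Cder_cont, Cder_circ. }
  pose proof (is_RInt_plus _ _ _ _ _ _ I2 I1) as I3.
  apply (@is_RInt_unique R_CompleteNormedModule) in I3.
  rewrite <- (Rplus_0_l (circle_integral R0 r)).
  change (@eq R (RInt (fun t => Re (c / (RtoC r * circ (RtoC t))) + Re (R0 (RtoC r * circ (RtoC t))%C))
    0 (2 * PI)) (0 + circle_integral R0 r)) in I3. rewrite <- I3.
  apply RInt_ge_0; [lra | |].
  - apply (@ex_RInt_plus R_NormedModule); [eexists; exact I2 | eexists; exact I1].
  - intros t _. specialize (Hpos (RtoC r * circ (RtoC t))%C).
    rewrite Cmod_on_circle in Hpos by lra. specialize (Hpos eq_refl).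
    rewrite HE in Hpos; [exact Hpos | apply on_circle_neq_0; lra | rewrite Cmod_on_circle; lra]. }
lra.
Qed.

(** * The binomial series of q_s *)

Lemma Cder_0_const (F : C -> C) : (forall z : C, Cmod z < 1 -> Cder F z 0) ->
  forall z : C, Cmod z < 1 -> F z = F 0.
Proof.
assert (K : forall F : C -> C, (forall z : C, Cmod z < 1 -> Cder F z 0) ->
  forall z : C, Cmod z < 1 -> Re (F z) = Re (F 0)).
{ intros F0 H z Hz.
  replace z with (RtoC 1 * z)%C at 1 by ring. replace (RtoC 0) with (RtoC 0 * z)%C by ring.
  symmetry. apply (eq_is_derive (fun t : R => Re (F0 (RtoC t * z)%C)) 0 1); [|lra].
  intros t Ht.
  assert (E : 0 = Re (0 * (1 * z + RtoC t * 0))) by (simpl; ring).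
  change (@zero R_NormedModule) with 0. rewrite E at 1.
  apply (is_derive_Re_of_Cder (fun u => F0 (u * z)%C)).
  apply (Cder_comp (fun u => u * z)%C F0).
  - apply (Cder_mult (fun u => u) (fun _ => z)); [apply Cder_id | apply Cder_const].
  - apply H. rewrite Cmod_mult, Cmod_R, Rabs_pos_eq by lra.
    pose proof (Cmod_ge_0 z). nra. }
intros H z Hz. apply Ceq_Re_Im; [apply K; assumption|].
assert (E : forall w, Im w = Re (- Ci * w)) by (intros w; simpl; unfold Im; ring).
rewrite !E. apply (K (fun w => - Ci * F w)%C); [|exact Hz].
intros w Hw. eapply Cder_eq.
- apply Cder_mult; [apply Cder_const | apply H, Hw].
- cbv beta. ring.
Qed.

(** The Taylor coefficients s (s+1) ... (s+n-1) / n! of (1 - z)^(-s). *)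
Fixpoint q_coeff (s : R) (n : nat) : R :=
  match n with
  | 0%nat => 1
  | S m => q_coeff s m * ((INR m + s) / INR (S m))
  end.

Lemma q_coeff_bound (s : R) (n : nat) : 0 < s <= 1 -> 0 <= q_coeff s n <= 1.
Proof.
intros Hs. induction n as [|n IH]; [simpl; lra|].
cbn [q_coeff]. pose proof (pos_INR n). rewrite S_INR.
assert (H1 : 0 <= (INR n + s) / (INR n + 1) <= 1).
{ split; [apply Rdiv_le_0_compat; lra|].
  apply Rmult_le_reg_r with (INR n + 1); [lra|]. unfold Rdiv.
  rewrite Rmult_assoc, Rinv_l by lra. lra. }
split; [apply Rmult_le_pos; lra|]. nra.
Qed.

Definition q_series (s : R) (n : nat) : C := RtoC (q_coeff s n).

Lemma Cmod_q_series (s : R) (n : nat) : 0 < s <= 1 -> Cmod (q_series s n) <= 1.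
Proof.
intros Hs. unfold q_series. rewrite Cmod_R. pose proof (q_coeff_bound s n Hs).
rewrite Rabs_pos_eq; lra.
Qed.

Lemma disk_conv_q_series (s : R) : 0 < s <= 1 -> disk_conv (q_series s).
Proof. intros Hs. apply disk_conv_bounded with 1. intros n; apply Cmod_q_series, Hs. Qed.

(** Coefficient by coefficient, this is (n+1) b_(n+1) - n b_n = s b_n. *)
Lemma q_series_ode (s : R) (z : C) : 0 < s <= 1 -> Cmod z < 1 ->
  ((1 - z) * CPS (CPS_derive (q_series s)) z = RtoC s * CPS (q_series s) z)%C.
Proof.
intros Hs Hz. set (b := q_series s). pose proof (disk_conv_q_series s Hs) as Hb. fold b in Hb.
pose proof (CPS_correct _ z (disk_conv_derive _ Hb) Hz) as H1.
pose proof (CPS_correct _ z Hb Hz) as H0.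
assert (H2 : Cseries (fun n => RtoC (INR n) * b n * z ^ n)%C (z * CPS (CPS_derive b) z)).
{ replace (z * CPS (CPS_derive b) z)%C
    with (RtoC (INR 0) * b 0%nat * z ^ 0 + z * CPS (CPS_derive b) z)%C by (simpl; ring).
  apply (Cseries_shift (fun n => RtoC (INR n) * b n * z ^ n)%C).
  apply (Cseries_ext (fun n => z * (CPS_derive b n * z ^ n))%C).
  - intros n. unfold CPS_derive. simpl Cpow. ring.
  - apply Cseries_scal, H1. }
pose proof (Cseries_minus _ _ _ _ H1 H2) as H3.
replace ((1 - z) * CPS (CPS_derive b) z)%C
  with (CPS (CPS_derive b) z - z * CPS (CPS_derive b) z)%C by ring.
apply (Cseries_unique _ _ _ H3).
apply (Cseries_ext (fun n => RtoC s * (b n * z ^ n))%C); [|apply Cseries_scal, H0].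
intros n. unfold CPS_derive, b, q_series. cbn [q_coeff].
assert (E : (RtoC s * RtoC (q_coeff s n))%C
  = (RtoC (INR (S n)) * RtoC (q_coeff s n * ((INR n + s) / INR (S n))) - RtoC (INR n) * RtoC (q_coeff s n))%C).
{ rewrite <- !RtoC_mult, <- RtoC_minus. f_equal. field. apply not_0_INR; lia. }
replace (RtoC s * (RtoC (q_coeff s n) * z ^ n))%C
  with (RtoC s * RtoC (q_coeff s n) * z ^ n)%C by ring.
rewrite E. ring.
Qed.

(** Both sides satisfy (1 - z) y' = s y, so their quotient is constant. *)
Lemma q_hpl_series (s : R) (z : C) : 0 < s <= 1 -> Cmod z < 1 ->
  q_hpl s z = CPS (q_series s) z.
Proof.
intros Hs Hz. pose proof (disk_conv_q_series s Hs) as Hb.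
set (F := fun w => (CPS (q_series s) w * / q_hpl s w)%C).
assert (HF : F z = F 0).
{ apply Cder_0_const; [|exact Hz]. intros w Hw. eapply Cder_eq.
  - apply Cder_mult; [apply CPS_Cder; assumption|].
    apply Cder_inv; [apply q_hpl_neq_0 | apply Cder_q_hpl, Hw].
  - cbv beta. pose proof (q_series_ode s w Hs Hw) as E.
    pose proof (one_minus_neq_0 w Hw) as H1. pose proof (q_hpl_neq_0 s w) as H2.
    replace (CPS (CPS_derive (q_series s)) w)
      with ((1 - w) * CPS (CPS_derive (q_series s)) w / (1 - w))%C by (field; exact H1).
    rewrite E. field; auto. }
unfold F in HF. rewrite q_hpl_0, CPS_0 in HF by exact Hb.
change (q_series s 0) with (RtoC 1) in HF.
pose proof (q_hpl_neq_0 s z) as Hq.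
replace (CPS (q_series s) z) with (CPS (q_series s) z * / q_hpl s z * q_hpl s z)%C
  by (field; exact Hq).
rewrite HF. field.
Qed.

Lemma q_hpl_taylor (s : R) : 0 < s <= 1 -> exists q2 : C -> C,
  Ccont q2 0 /\ q2 0 = RtoC (s * (s + 1) / 2) /\
  forall w : C, Cmod w < 1 -> q_hpl s w = (1 + RtoC s * w + w * w * q2 w)%C.
Proof.
intros Hs. pose proof (disk_conv_q_series s Hs) as Hb.
pose proof (disk_conv_shift _ Hb) as Hb1. pose proof (disk_conv_shift _ Hb1) as Hb2.
assert (H0 : Cmod 0 < 1) by (rewrite Cmod_0; lra).
exists (CPS (fun n => q_series s (S (S n)))). split; [|split].
- apply CPS_cont; assumption.
- rewrite CPS_0 by exact Hb2. unfold q_series. f_equal. simpl. field.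
- intros w Hw. rewrite q_hpl_series, (CPS_shift _ w Hb Hw), (CPS_shift _ w Hb1 Hw) by assumption.
  replace (q_series s 0) with (RtoC 1) by reflexivity.
  replace (q_series s 1) with (RtoC s) by (unfold q_series; f_equal; simpl; field).
  ring.
Qed.

(** * The second coefficient of a Schwarz function *)

Lemma Cmod2_plus (p q : C) :
  Cmod (p + q) ^ 2 = Cmod p ^ 2 + Cmod q ^ 2 + 2 * Re (Cconj p * q).
Proof. rewrite !Cmod2_alt. destruct p, q; simpl. ring. Qed.

Lemma Cmod2_minus (p q : C) :
  Cmod (p - q) ^ 2 = Cmod p ^ 2 + Cmod q ^ 2 - 2 * Re (Cconj p * q).
Proof. rewrite !Cmod2_alt. destruct p, q; simpl. ring. Qed.

Section Schwarz.
Variables (omega G : C -> C) (c1 : C).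
Hypothesis Hhol : C1hol omega.
Hypothesis Hlt : forall z : C, Cmod z < 1 -> Cmod (omega z) < 1.
Hypothesis HG : Ccont G 0.
Hypothesis Hexp : forall z : C, z <> 0 -> Cmod z < 1 -> omega z = (c1 * z + z * z * G z)%C.

(** Bessel's inequality for u = omega (x + y z) on |z| = r: the coefficients of z
    and z^2 in u are A and B, and |u| <= |x + y z|. *)
Lemma bessel_on_circle (x y : C) (r : R) : 0 < r < 1 ->
  r ^ 2 * Cmod (c1 * x) ^ 2 + r ^ 4 * Cmod (c1 * y + G 0 * x) ^ 2
  <= Cmod x ^ 2 + r ^ 2 * Cmod y ^ 2.
Proof.
intros Hr. set (A := (c1 * x)%C). set (B := (c1 * y + G 0 * x)%C).
set (K := Cmod x ^ 2 + r ^ 2 * Cmod y ^ 2 + r ^ 2 * Cmod A ^ 2 + r ^ 4 * Cmod B ^ 2).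
(* With v = A z + B z^2 and |z| = r, the conjugate of v is r^2 A^* / z + r^4 B^* / z^2.
   So H is holomorphic, and on |z| = r its real part is
   |x + y z|^2 + |v|^2 - 2 Re (v^* u) >= |v - u|^2 >= 0. *)
set (H := fun z => (RtoC K + 2 * Cconj x * y * z + 2 * RtoC (r ^ 2) * Cconj A * B * z
  - 2 * (RtoC (r ^ 2) * Cconj A * / z + RtoC (r ^ 4) * Cconj B * (/ z * / z))
    * (omega z * (x + y * z)))%C).
set (R0 := fun z => (RtoC K + 2 * Cconj x * y * z + 2 * RtoC (r ^ 2) * Cconj A * B * z
  - (2 * RtoC (r ^ 2) * Cconj A * ((c1 + z * G z) * (x + y * z))
     + 2 * RtoC (r ^ 4) * Cconj B * (c1 * y + G z * (x + y * z))))%C).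
assert (HR : 0 <= Re (R0 0)).
{ apply (circle_positivity H R0 (- 2 * RtoC (r ^ 4) * Cconj B * (c1 * x)) r Hr).
  - assert (Hi : C1hol (fun z => / z)%C) by (apply C1hol_inv; [auto | apply C1hol_id]).
    repeat first [ apply C1hol_minus | apply C1hol_plus | apply C1hol_const
      | apply C1hol_mult | apply C1hol_id | exact Hi | exact Hhol ].
  - intros z H0 H1. unfold H, R0. rewrite Hexp by assumption. field. exact H0.
  - repeat first [ apply Ccont_minus | apply Ccont_plus | apply Ccont_const
      | apply Ccont_mult | apply Ccont_id | exact HG ].
  - intros z Hz.
    assert (Hz0 : z <> 0) by (apply Cmod_gt_0; lra).
    assert (Hzz : RtoC (r ^ 2) = (z * Cconj z)%C) by (rewrite <- Cmod2_conj, Hz; reflexivity).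
    set (v := (A * z + B * (z * z))%C). set (u := (omega z * (x + y * z))%C).
    assert (Hv : (RtoC (r ^ 2) * Cconj A * / z + RtoC (r ^ 4) * Cconj B * (/ z * / z))%C = Cconj v).
    { replace (r ^ 4) with (r ^ 2 * r ^ 2) by ring. rewrite RtoC_mult, Hzz. unfold v.
      rewrite Cplus_conj, !Cmult_conj. field. exact Hz0. }
    unfold H. fold u. rewrite Hv.
    assert (E1 : Cmod (x + y * z) ^ 2 = Cmod x ^ 2 + r ^ 2 * Cmod y ^ 2 + 2 * Re (Cconj x * y * z)).
    { rewrite Cmod2_plus, Cmod_mult, Hz.
      replace (Cconj x * (y * z))%C with (Cconj x * y * z)%C by ring. ring. }
    assert (E2 : Cmod v ^ 2 = r ^ 2 * Cmod A ^ 2 + r ^ 4 * Cmod B ^ 2 + 2 * Re (RtoC (r ^ 2) * Cconj A * B * z)).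
    { unfold v. rewrite Cmod2_plus, !Cmod_mult, Hz, Cmult_conj.
      replace (Cconj A * Cconj z * (B * (z * z)))%C with (z * Cconj z * Cconj A * B * z)%C by ring.
      rewrite <- Hzz. ring. }
    assert (E3 : Cmod u ^ 2 <= Cmod (x + y * z) ^ 2).
    { apply pow_incr. split; [apply Cmod_ge_0|]. unfold u. rewrite Cmod_mult.
      specialize (Hlt z ltac:(lra)). pose proof (Cmod_ge_0 (x + y * z)). nra. }
    pose proof (Cmod2_minus v u) as E4. pose proof (pow2_ge_0 (Cmod (v - u))) as E5.
    set (p1 := (Cconj x * y * z)%C) in *. set (p2 := (RtoC (r ^ 2) * Cconj A * B * z)%C) in *.
    set (p3 := (Cconj v * u)%C) in *.
    replace (RtoC K + 2 * Cconj x * y * z + 2 * RtoC (r ^ 2) * Cconj A * B * z - 2 * Cconj v * u)%C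
      with (RtoC K + 2 * p1 + 2 * p2 - 2 * p3)%C by (unfold p1, p2, p3; ring).
    replace (Re (RtoC K + 2 * p1 + 2 * p2 - 2 * p3)) with (K + 2 * Re p1 + 2 * Re p2 - 2 * Re p3)
      by (simpl; unfold Re; ring).
    unfold K. lra. }
assert (E : R0 0 = RtoC (Cmod x ^ 2 + r ^ 2 * Cmod y ^ 2 - r ^ 2 * Cmod A ^ 2 - r ^ 4 * Cmod B ^ 2)).
{ unfold R0.
  replace (2 * RtoC (r ^ 2) * Cconj A * ((c1 + 0 * G 0) * (x + y * 0))
    + 2 * RtoC (r ^ 4) * Cconj B * (c1 * y + G 0 * (x + y * 0)))%C
    with (2 * RtoC (r ^ 2) * (A * Cconj A) + 2 * RtoC (r ^ 4) * (B * Cconj B))%C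
    by (unfold A, B; ring).
  rewrite <- !Cmod2_conj. unfold K.
  rewrite !RtoC_minus, !RtoC_plus, !RtoC_mult. ring. }
rewrite E in HR. simpl Re in HR. lra.
Qed.

Lemma bessel_limit (x y : C) :
  Cmod (c1 * x) ^ 2 + Cmod (c1 * y + G 0 * x) ^ 2 <= Cmod x ^ 2 + Cmod y ^ 2.
Proof.
pose proof (bessel_on_circle x y) as H.
set (a := Cmod (c1 * x) ^ 2) in *. set (b := Cmod (c1 * y + G 0 * x) ^ 2) in *.
set (X := Cmod x ^ 2) in *. set (Y := Cmod y ^ 2) in *.
assert (Ha : 0 <= a) by apply pow2_ge_0. assert (Hb : 0 <= b) by apply pow2_ge_0.
assert (HY : 0 <= Y) by apply pow2_ge_0.
destruct (Rle_or_lt (a + b) (X + Y)) as [|Hlt']; [assumption|exfalso].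
set (D := a + b - (X + Y)).
set (e := Rmin (1 / 2) (D / (8 * (a + b + 1)))).
assert (HD : 0 < D) by (unfold D; lra).
assert (He0 : 0 < e) by (apply Rmin_pos; [lra | apply Rdiv_lt_0_compat; lra]).
assert (He1 : e <= 1 / 2) by apply Rmin_l.
assert (He2 : e * (8 * (a + b + 1)) <= D).
{ apply Rle_trans with (D / (8 * (a + b + 1)) * (8 * (a + b + 1))).
  - apply Rmult_le_compat_r; [lra | apply Rmin_r].
  - right; field; lra. }
specialize (H (1 - e) ltac:(lra)).
assert (H2 : 1 - 4 * e <= (1 - e) ^ 2 <= 1) by (simpl; nra).
assert (H4 : 1 - 4 * e <= (1 - e) ^ 4).
{ replace ((1 - e) ^ 4) with ((1 - e) ^ 2 * (1 - e) ^ 2) by ring.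
  assert (1 - 2 * e <= (1 - e) ^ 2) by (simpl; nra). nra. }
assert ((1 - 4 * e) * a <= (1 - e) ^ 2 * a) by (apply Rmult_le_compat_r; lra).
assert ((1 - 4 * e) * b <= (1 - e) ^ 4 * b) by (apply Rmult_le_compat_r; lra).
assert ((1 - e) ^ 2 * Y <= 1 * Y) by (apply Rmult_le_compat_r; lra).
unfold D in *. nra.
Qed.

(** The contraction inequality is used at (x, y) = (1, 0) and at
    (x, y) = (1 - |c1|^2, c1^* c2); the latter makes c1 y + c2 x equal to c2. *)
Lemma schwarz_second_coeff : Cmod c1 ^ 2 <= 1 /\ Cmod (G 0) <= 1 - Cmod c1 ^ 2.
Proof.
set (k := Cmod c1 ^ 2). set (c2 := G 0).
pose proof (bessel_limit 1 0) as H1.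
pose proof (bessel_limit (RtoC (1 - k)) (Cconj c1 * c2)) as H2. fold c2 in H1, H2.
replace (c1 * 1)%C with c1 in H1 by ring.
replace (c1 * 0 + c2 * 1)%C with c2 in H1 by ring.
rewrite Cmod_1, Cmod_0 in H1. fold k in H1.
replace (c1 * (Cconj c1 * c2) + c2 * RtoC (1 - k))%C with c2 in H2.
2:{ replace (c1 * (Cconj c1 * c2))%C with (c1 * Cconj c1 * c2)%C by ring.
    rewrite <- Cmod2_conj. fold k. rewrite RtoC_minus. ring. }
rewrite !Cmod_mult, Cmod_conj, Cmod_R, !Rpow_mult_distr, pow2_abs in H2. fold k in H2.
pose proof (Cmod_ge_0 c2) as Hm. pose proof (pow2_ge_0 (Cmod c1)) as Hk. fold k in Hk.
set (m := Cmod c2) in *.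
assert (Hk1 : k <= 1) by (pose proof (pow2_ge_0 m); simpl in *; lra).
split; [exact Hk1|].
destruct (Req_dec k 1) as [E|E].
- rewrite E in *. assert (m * m <= 0) by (simpl in H1; lra).
  assert (m = 0) by nra. lra.
- assert (Hp : 0 < 1 - k) by lra.
  assert (H3 : (1 - k) * (m * m) <= (1 - k) * ((1 - k) * (1 - k))) by (simpl in H2; nra).
  apply Rmult_le_reg_l in H3; [|exact Hp]. nra.
Qed.

Lemma schwarz_fekete_szego (mu : R) :
  Cmod (G 0 + RtoC mu * c1 ^ 2) <= Rmax 1 (Rabs mu).
Proof.
destruct schwarz_second_coeff as [H1 H2].
eapply Rle_trans; [apply Cmod_triangle|]. rewrite Cmod_mult, Cmod_R, Cmod_pow.
set (k := Cmod c1 ^ 2) in *. assert (Hk : 0 <= k) by apply pow2_ge_0.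
pose proof (Rmax_l 1 (Rabs mu)). pose proof (Rmax_r 1 (Rabs mu)).
set (M := Rmax 1 (Rabs mu)) in *.
assert (Rabs mu * k <= M * k) by (apply Rmult_le_compat_r; lra). nra.
Qed.
End Schwarz.

(** * The upper bound *)

(** The Schwarz function omega of f with its second order expansion, and the
    coefficients a2, a3 in terms of it. The regularity of omega and the expansion
    both come from f' = (f/z) q_s(omega), where f' and f/z are power series. *)
Lemma starlike_schwarz_data (s : R) (f : C -> C) (a : nat -> C) : 0 < s <= 1 ->
  class_ST_hpl s f -> normalized_expansion f a ->
  exists (omega G : C -> C) (c1 : C), C1hol omega /\
    (forall z : C, Cmod z < 1 -> Cmod (omega z) < 1) /\ Ccont G 0 /\
    (forall z : C, z <> 0 -> Cmod z < 1 -> omega z = (c1 * z + z * z * G z)%C) /\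
    a 2%nat = (RtoC s * c1)%C /\
    a 3%nat = (RtoC (s / 2) * (G 0 + RtoC ((3 * s + 1) / 2) * c1 ^ 2))%C.
Proof.
intros Hs [[Hhol [Huni _]] [omega [Homh [Homd [Hom0 Hsub]]]]] [Ha0 [Ha1 Hps]].
pose proof (pseries_disk_conv a f Hps) as Ha.
pose proof (fun z => pseries_eq_CPS a f z Hps) as Hf.
assert (H0d : Cmod 0 < 1) by (rewrite Cmod_0; lra).
assert (HsC : RtoC s <> 0) by (intros E; apply RtoC_inj in E; lra).
pose proof (disk_conv_shift _ Ha) as Ha'. pose proof (disk_conv_shift _ Ha') as Ha''.
pose proof (disk_conv_shift _ Ha'') as Ha3.
pose proof (disk_conv_derive _ Ha) as Hd. pose proof (disk_conv_shift _ Hd) as Hd'.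
pose proof (disk_conv_shift _ Hd') as Hd''.
set (h := CPS (fun n => a (S n))) in *. set (f1 := CPS (CPS_derive a)) in *.
assert (Hfh : forall z : C, Cmod z < 1 -> f z = (z * h z)%C).
{ intros z Hz. rewrite Hf, (CPS_shift a z Ha Hz), Ha0 by exact Hz. unfold h. ring. }
assert (Hh0 : forall z : C, z <> 0 -> Cmod z < 1 -> h z <> 0).
{ intros z H0 H1 E. apply H0, Huni; [exact H1 | exact H0d|].
  rewrite !Hfh, E by assumption. ring. }
assert (Hder : forall z : C, Cmod z < 1 -> C_derive f z = f1 z).
{ intros z Hz. apply is_C_derive_unique, Cder_is_derive.
  apply (Cder_local (CPS a) f z _ (1 - Cmod z)); [lra| |apply CPS_Cder; assumption].
  intros w Hw. symmetry. apply Hf. pose proof (Cmod_triangle_inv w z). lra. }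
assert (Hp : forall z : C, z <> 0 -> Cmod z < 1 -> q_hpl s (omega z) = (f1 z * / h z)%C).
{ intros z H0 H1. rewrite <- Hsub by exact H1. unfold zf'_over_f.
  destruct (Ceq_dec z 0) as [E|_]; [contradiction|].
  rewrite Hder, Hfh by exact H1. field. split; [apply Hh0|]; assumption. }
assert (HomC : forall z : C, Cmod z < 1 -> exists l, Cder omega z l).
{ intros z Hz. destruct (Homh z Hz) as [l Hl]. exists l. apply Cder_is_derive, Hl. }
assert (HP : C1hol (fun z => f1 z * / h z)%C).
{ assert (K : forall b, disk_conv b -> C1hol (CPS b)).
  { intros b Hb. exists (CPS (CPS_derive b)). intros z _ Hz. split.
    - apply CPS_Cder; assumption.
    - apply CPS_cont; [apply disk_conv_derive|]; assumption. }
  apply C1hol_mult; [apply K, Hd|]. apply C1hol_inv; [exact Hh0 | apply K, Ha']. }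
(* The derivative of omega is recovered from p' = q_s'(omega) omega', where
   q_s'(w) = s q_s(w) / (1 - w), hence it is continuous. *)
assert (HomC1 : C1hol omega).
{ destruct HP as [P' HP].
  exists (fun z => P' z * (1 - omega z) * / (RtoC s * q_hpl s (omega z)))%C.
  intros z H0 H1. destruct (HomC z H1) as [l Hl]. destruct (HP z H0 H1) as [DP CP].
  pose proof (Cder_cont _ _ _ Hl) as Co. pose proof (Homd z H1) as Hoz.
  assert (Dq : Cder (fun z => q_hpl s (omega z)) z (RtoC s * q_hpl s (omega z) / (1 - omega z) * l)).
  { apply (Cder_comp omega (q_hpl s)); [exact Hl | apply Cder_q_hpl, Hoz]. }
  assert (E : P' z = (RtoC s * q_hpl s (omega z) / (1 - omega z) * l)%C).
  { destruct (punctured_ball z H0 H1) as [r [Hr Hb]].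
    apply (Cder_unique (fun z => q_hpl s (omega z)) z); [|exact Dq].
    apply (Cder_local _ _ z _ r Hr) with (2 := DP).
    intros w Hw. symmetry. apply Hp; apply Hb, Hw. }
  split.
  - apply (Cder_eq _ _ _ _ Hl). rewrite E. field.
    split; [apply q_hpl_neq_0 | split; [exact HsC | apply one_minus_neq_0, Hoz]].
  - apply Ccont_mult.
    + apply Ccont_mult; [exact CP|]. apply Ccont_minus; [apply Ccont_const | exact Co].
    + apply Ccont_inv; [apply Cmult_neq_0; [exact HsC | apply q_hpl_neq_0]|].
      apply Ccont_mult; [apply Ccont_const|].
      apply (Ccont_comp omega (q_hpl s)); [exact Co|]. eapply Cder_cont, Cder_q_hpl, Hoz. }
destruct (HomC 0 H0d) as [l Hl]. pose proof (Cder_cont _ _ _ Hl) as Com0.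
destruct Hl as [g [Hg [_ Hgz]]].
assert (Hgo : forall z, omega z = (z * g z)%C) by (intros z; rewrite Hgz, Hom0; ring).
destruct (q_hpl_taylor s Hs) as [q2 [Hq2 [Hq20 Hq]]].
set (h2 := CPS (fun n => a (S (S (S n))))). set (e2 := CPS (fun n => CPS_derive a (S (S n)))).
assert (Hhz : forall z : C, Cmod z < 1 -> h z = (1 + a 2%nat * z + z * z * h2 z)%C).
{ intros z Hz. unfold h. rewrite (CPS_shift _ z Ha' Hz), (CPS_shift _ z Ha'' Hz), Ha1.
  unfold h2. ring. }
assert (Hez : forall z : C, Cmod z < 1 -> f1 z = (1 + 2 * a 2%nat * z + z * z * e2 z)%C).
{ intros z Hz. unfold f1. rewrite (CPS_shift _ z Hd Hz), (CPS_shift _ z Hd' Hz).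
  unfold CPS_derive at 1 2. rewrite Ha1. unfold e2. simpl INR.
  replace (1 + 1) with 2 by ring. ring. }
assert (Ch2 : Ccont h2 0) by (apply CPS_cont; assumption).
assert (Ce2 : Ccont e2 0) by (apply CPS_cont; assumption).
assert (Ch : Ccont h 0) by (apply CPS_cont; assumption).
assert (Cq2 : Ccont (fun z => q2 (omega z)) 0).
{ apply (Ccont_comp omega q2); [exact Com0 | rewrite Hom0; exact Hq2]. }
(* With omega = z g, f' = 1 + 2 a2 z + z^2 e2, h = 1 + a2 z + z^2 h2 and
   q_s(w) = 1 + s w + w^2 q2, the identity f' = h q_s(omega) becomes
   s g h = a2 + z T after division by z. *)
set (T := fun z => (e2 z - h2 z - g z * g z * q2 (omega z) * h z)%C).
assert (CT : Ccont T 0).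
{ unfold T. repeat first [assumption | apply Ccont_minus | apply Ccont_mult]. }
assert (HT : forall z : C, z <> 0 -> Cmod z < 1 -> (RtoC s * g z * h z = a 2%nat + z * T z)%C).
{ intros z H0 H1.
  assert (E : f1 z = (q_hpl s (omega z) * h z)%C).
  { rewrite Hp by assumption. field. apply Hh0; assumption. }
  rewrite Hq in E by (apply Homd; exact H1). rewrite Hgo in E at 1 2 3.
  assert (E2 : (z * (RtoC s * g z * h z) = z * (a 2%nat + z * T z))%C).
  { unfold T. 
    replace (z * (RtoC s * g z * h z))%C
      with ((1 + RtoC s * (z * g z) + z * g z * (z * g z) * q2 (omega z)) * h z
            - h z - z * z * (g z * g z * q2 (omega z) * h z))%C by ring.
    rewrite <- E, (Hez z H1), (Hhz z H1) at 1. ring. }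
  replace (RtoC s * g z * h z)%C with (z * (RtoC s * g z * h z) / z)%C by (field; exact H0).
  rewrite E2. field. exact H0. }
assert (Hh00 : h 0 = 1) by (unfold h; rewrite CPS_0; assumption).
assert (Ha2 : (a 2%nat = RtoC s * g 0)%C).
{ transitivity (RtoC s * g 0 * h 0)%C; [|rewrite Hh00; ring].
  symmetry. transitivity (a 2%nat + 0 * T 0)%C; [|ring].
  apply (Ccont_eq_of_punctured (fun z => RtoC s * g z * h z)%C (fun z => a 2%nat + z * T z)%C 0 1).
  - lra.
  - repeat first [assumption | apply Ccont_const | apply Ccont_mult].
  - repeat first [assumption | apply Ccont_const | apply Ccont_id | apply Ccont_plus | apply Ccont_mult].
  - intros w H0 H1. apply HT; [exact H0|]. replace (w - 0)%C with w in H1 by ring. exact H1. }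
(* Replacing h by 1 + z (a2 + z h2) in s g h = a2 + z T gives g = g(0) + z U. *)
set (U := fun z => ((T z - RtoC s * g z * (a 2%nat + z * h2 z)) * / RtoC s)%C).
exists omega, U, (g 0). split; [exact HomC1|]. split; [exact Homd|]. split; [|split; [|split]].
- unfold U. repeat first [assumption | apply Ccont_const | apply Ccont_id | apply Ccont_minus
    | apply Ccont_plus | apply Ccont_mult].
- intros z H0 H1. rewrite Hgo.
  assert (E : (RtoC s * g z = RtoC s * g 0 + z * (RtoC s * U z))%C).
  { rewrite <- Ha2. unfold U.
    replace (RtoC s * ((T z - RtoC s * g z * (a 2%nat + z * h2 z)) * / RtoC s))%C
      with (T z - RtoC s * g z * (a 2%nat + z * h2 z))%C by (field; exact HsC).
    replace (a 2%nat + z * (T z - RtoC s * g z * (a 2%nat + z * h2 z)))%C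
      with ((a 2%nat + z * T z) - RtoC s * g z * (z * (a 2%nat + z * h2 z)))%C by ring.
    rewrite <- HT by assumption. rewrite (Hhz z H1). ring. }
  replace (g z) with (RtoC s * g z / RtoC s)%C by (field; exact HsC).
  rewrite E. field. exact HsC.
- exact Ha2.
- unfold U, T.
  assert (He20 : e2 0 = (3 * a 3%nat)%C).
  { unfold e2. rewrite CPS_0 by exact Hd''. unfold CPS_derive. f_equal. simpl. f_equal. ring. }
  assert (Hh20 : h2 0 = a 3%nat) by (unfold h2; rewrite CPS_0; [reflexivity | exact Ha3]).
  rewrite He20, Hh20, Hom0, Hq20, Hh00, Ha2.
  rewrite !RtoC_div, !RtoC_mult, !RtoC_plus, !RtoC_mult by lra.
  simpl Cpow. field. exact HsC.
Qed.

Lemma fekete_szego_bound (s lam : R) (f : C -> C) (a : nat -> C) : 0 < s <= 1 ->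
  class_ST_hpl s f -> normalized_expansion f a ->
  Cmod (a 3%nat - RtoC lam * a 2%nat ^ 2) <= s / 2 * Rmax 1 (Rabs ((3 * s + 1) / 2 - 2 * s * lam)).
Proof.
intros Hs Hf Ha.
destruct (starlike_schwarz_data s f a Hs Hf Ha) as [omega [G [c1 [H1 [H2 [H3 [H4 [-> ->]]]]]]]].
pose proof (schwarz_fekete_szego omega G c1 H1 H2 H3 H4 ((3 * s + 1) / 2 - 2 * s * lam)) as H.
replace (RtoC (s / 2) * (G 0 + RtoC ((3 * s + 1) / 2) * c1 ^ 2) - RtoC lam * (RtoC s * c1) ^ 2)%C
  with (RtoC (s / 2) * (G 0 + RtoC ((3 * s + 1) / 2 - 2 * s * lam) * c1 ^ 2))%C.
- rewrite Cmod_mult, Cmod_R, Rabs_pos_eq by lra. apply Rmult_le_compat_l; [lra | exact H].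
- rewrite !RtoC_minus, !RtoC_div, !RtoC_mult, RtoC_plus, RtoC_mult by lra. simpl Cpow. field.
Qed.

(** * A univalence criterion *)

(** By the mean value theorem, Re ((F(b) - F(a)) / (b - a)) is a value of Re F'
    on the segment from a to b, which stays in the half-plane. *)
Lemma noshiro_warschawski (F F' : C -> C) (a b : C) :
  (forall u : C, Re u < 0 -> Cder F u (F' u) /\ 0 < Re (F' u)) ->
  Re a < 0 -> Re b < 0 -> F a = F b -> a = b.
Proof.
intros HF Ha Hb E. destruct (Ceq_dec a b) as [|Hn]; [assumption|exfalso].
assert (Hd : (b - a)%C <> 0) by (apply Csub_neq; auto).
set (d := (b - a)%C) in *.
assert (Hpath : forall t : R, 0 <= t <= 1 -> Re (a + RtoC t * d) < 0).
{ intros t Ht. replace (Re (a + RtoC t * d)) with ((1 - t) * Re a + t * Re b)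
    by (unfold d; simpl; unfold Re; ring). nra. }
assert (HD : forall t : R, 0 <= t <= 1 ->
  is_derive (fun t : R => Re (F (a + RtoC t * d)%C * / d)) t (Re (F' (a + RtoC t * d)%C))).
{ intros t Ht. apply (is_derive_Re_of_Cder (fun u => F (a + u * d) * / d)%C).
  eapply Cder_eq.
  - apply Cder_mult; [|apply Cder_const].
    apply (Cder_comp (fun u => a + u * d)%C F); [|apply HF, Hpath, Ht].
    apply Cder_plus; [apply Cder_const|].
    apply Cder_mult; [apply Cder_id | apply Cder_const].
  - cbv beta. field. exact Hd. }
destruct (MVT_gen (fun t : R => Re (F (a + RtoC t * d)%C * / d)) 0 1
  (fun t => Re (F' (a + RtoC t * d)%C))) as [c [Hc Hv]].
- intros t Ht. rewrite Rmin_left, Rmax_right in Ht by lra. apply HD. lra.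
- intros t Ht. rewrite Rmin_left, Rmax_right in Ht by lra.
  apply continuity_pt_filterlim.
  apply (@ex_derive_continuous R_AbsRing R_NormedModule). eexists. apply HD, Ht.
- rewrite Rmin_left, Rmax_right in Hc by lra.
  replace (a + 1 * d)%C with b in Hv by (unfold d; ring).
  replace (a + 0 * d)%C with a in Hv by ring.
  rewrite E in Hv. pose proof (proj2 (HF _ (Hpath c Hc))). lra.
Qed.

Lemma Cmod_Cexp_lt_1 (u : C) : Re u < 0 -> Cmod (Cexp u) < 1.
Proof. intros H. rewrite Cmod_Cexp, <- exp_0. apply exp_increasing, H. Qed.

(** If z = e^u and L(u) = u + Q(e^u), then z exp(Q(z)) = e^(L(u)). Two points with
    equal values have L(u1) = L(u2) + 2 pi i k = L(u2 + 2 pi i k), and injectivity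
    of L on the left half-plane gives e^(u1) = e^(u2). *)
Lemma univalent_of_log_derivative (Q B : C -> C) :
  (forall z : C, Cmod z < 1 -> Cder Q z (B z)) ->
  (forall z : C, Cmod z < 1 -> 0 < Re (1 + z * B z)) ->
  univalent_in_disk (fun z => z * Cexp (Q z))%C.
Proof.
intros HQ Hpos z1 z2 H1 H2 E. unfold unit_disk in *.
assert (K0 : forall v w : C, (v * Cexp w)%C = 0 -> v = 0).
{ intros v w H. replace v with (v * Cexp w * / Cexp w)%C by (field; apply Cexp_neq_0).
  rewrite H. ring. }
destruct (Ceq_dec z1 0) as [->|N1].
{ symmetry; apply (K0 z2 (Q z2)). rewrite <- E. ring. }
destruct (Ceq_dec z2 0) as [->|N2].
{ apply (K0 z1 (Q z1)). rewrite E. ring. }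
destruct (polar_form z1 N1) as [u1 ->]. destruct (polar_form z2 N2) as [u2 ->].
rewrite <- !Cexp_plus in E.
assert (E1 : Cexp (u1 + Q (Cexp u1) + - (u2 + Q (Cexp u2))) = 1).
{ rewrite Cexp_plus, E, <- Cexp_plus, <- Cexp_0. f_equal. ring. }
apply Cexp_eq_1 in E1. destruct E1 as [k Hk].
pose proof (Cexp_period k) as Hp. set (p := (0, 2 * IZR k * PI) : C) in *.
assert (Ep : Cexp (u2 + p) = Cexp u2) by (rewrite Cexp_plus, Hp; ring).
assert (Hneg : forall u, Cmod (Cexp u) < 1 -> Re u < 0).
{ intros u Hu. rewrite Cmod_Cexp, <- exp_0 in Hu. apply exp_lt_inv, Hu. }
rewrite <- Ep. f_equal.
apply (noshiro_warschawski (fun u => u + Q (Cexp u))%C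
  (fun u => 1 + Cexp u * B (Cexp u))%C).
- intros u Hu. pose proof (Cmod_Cexp_lt_1 u Hu) as Hd. split; [|apply Hpos, Hd].
  eapply Cder_eq.
  + apply Cder_plus; [apply Cder_id|].
    apply (Cder_comp Cexp Q); [apply Cder_Cexp | apply HQ, Hd].
  + ring.
- apply Hneg, H1.
- apply Hneg. rewrite Ep. exact H2.
- cbv beta. rewrite Ep.
  replace (u1 + Q (Cexp u1))%C
    with ((u1 + Q (Cexp u1) + - (u2 + Q (Cexp u2))) + (u2 + Q (Cexp u2)))%C by ring.
  rewrite Hk. ring.
Qed.

(** * Starlike functions with prescribed logarithmic derivative *)

Section ExpSeries.
Variable beta : nat -> C.
Hypothesis Hbeta : forall n, Cmod (beta n) <= 1.

(** The recursion (n+1) h_(n+1) = sum_k beta_k h_(n-k) uses all earlier values, so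
    the value at n of this function is a whole table, correct up to index n. *)
Fixpoint exp_coeff_upto (n : nat) : nat -> C :=
  match n with
  | 0%nat => fun _ => RtoC 1
  | S m => fun k => if Nat.leb k m then exp_coeff_upto m k
      else (/ RtoC (INR (S m)) *
            @sum_n C_AbelianMonoid (fun j => beta j * exp_coeff_upto m (m - j)%nat)%C m)%C
  end.

Definition exp_coeff (n : nat) : C := exp_coeff_upto n n.

Lemma exp_coeff_upto_eq (n k : nat) : (k <= n)%nat -> exp_coeff_upto n k = exp_coeff k.
Proof.
induction n as [|n IH]; intros Hk.
- replace k with 0%nat by lia. reflexivity.
- destruct (Nat.eq_dec k (S n)) as [->|Hn]; [reflexivity|].
  cbn [exp_coeff_upto]. rewrite (proj2 (Nat.leb_le k n)) by lia. apply IH; lia.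
Qed.

Lemma exp_coeff_S (n : nat) : exp_coeff (S n) =
  (/ RtoC (INR (S n)) * @sum_n C_AbelianMonoid (fun j => beta j * exp_coeff (n - j)%nat)%C n)%C.
Proof.
unfold exp_coeff at 1. cbn [exp_coeff_upto].
rewrite (proj2 (Nat.leb_gt (S n) n)) by lia. f_equal.
apply sum_n_ext_loc. intros j Hj. rewrite exp_coeff_upto_eq by lia. reflexivity.
Qed.

Lemma INR_S_neq_0 (n : nat) : RtoC (INR (S n)) <> 0.
Proof. intros E. apply RtoC_inj in E. revert E. apply not_0_INR; lia. Qed.

Lemma Cmod_sum_n_le (u : nat -> C) (n : nat) : (forall k, (k <= n)%nat -> Cmod (u k) <= 1) ->
  Cmod (@sum_n C_AbelianMonoid u n) <= INR (S n).
Proof.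
induction n as [|n IH]; intros H.
- rewrite sum_O. simpl. apply H; lia.
- rewrite sum_Sn. change (Cmod (@sum_n C_AbelianMonoid u n + u (S n)) <= INR (S (S n))).
  eapply Rle_trans; [apply Cmod_triangle|]. rewrite S_INR. apply Rplus_le_compat.
  + apply IH. intros k Hk; apply H; lia.
  + apply H; lia.
Qed.

(** A sum of n+1 terms of modulus at most 1 is divided by n+1. *)
Lemma exp_coeff_bound (n : nat) : Cmod (exp_coeff n) <= 1.
Proof.
induction n as [n IH] using (well_founded_induction Wf_nat.lt_wf). destruct n as [|n].
- unfold exp_coeff; simpl. rewrite Cmod_1. lra.
- rewrite exp_coeff_S, Cmod_mult, Cmod_inv, Cmod_R by apply INR_S_neq_0.
  assert (Hp : 0 < INR (S n)) by (apply lt_0_INR; lia).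
  rewrite Rabs_pos_eq by lra.
  apply Rmult_le_reg_l with (INR (S n)); [exact Hp|].
  rewrite <- Rmult_assoc, Rinv_r, Rmult_1_l, Rmult_1_r by lra.
  apply Cmod_sum_n_le. intros k Hk. rewrite Cmod_mult.
  specialize (Hbeta k). specialize (IH (n - k)%nat ltac:(lia)).
  pose proof (Cmod_ge_0 (beta k)). pose proof (Cmod_ge_0 (exp_coeff (n - k)%nat)). nra.
Qed.

Definition primitive_coeff (n : nat) : C :=
  match n with 0%nat => RtoC 0 | S m => (beta m / RtoC (INR (S m)))%C end.

Lemma disk_conv_beta : disk_conv beta.
Proof. apply disk_conv_bounded with 1, Hbeta. Qed.

Lemma disk_conv_exp_coeff : disk_conv exp_coeff.
Proof. apply disk_conv_bounded with 1, exp_coeff_bound. Qed.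

Lemma disk_conv_primitive : disk_conv primitive_coeff.
Proof.
apply disk_conv_bounded with 1. intros [|n]; cbn [primitive_coeff].
- rewrite Cmod_0; lra.
- rewrite Cmod_div, Cmod_R by apply INR_S_neq_0.
  assert (Hp : 1 <= INR (S n)) by (rewrite S_INR; pose proof (pos_INR n); lra).
  rewrite Rabs_pos_eq by lra. apply Rmult_le_reg_r with (INR (S n)); [lra|].
  unfold Rdiv. rewrite Rmult_assoc, Rinv_l by lra. specialize (Hbeta n). lra.
Qed.

Lemma Cder_primitive (z : C) : Cmod z < 1 -> Cder (CPS primitive_coeff) z (CPS beta z).
Proof.
intros Hz. eapply Cder_eq; [apply CPS_Cder; [apply disk_conv_primitive | exact Hz]|].
eapply Cseries_unique.
- apply CPS_correct; [apply disk_conv_derive, disk_conv_primitive | exact Hz].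
- eapply Cseries_ext; [|apply CPS_correct; [apply disk_conv_beta | exact Hz]].
  intros n. unfold CPS_derive. cbn [primitive_coeff]. field. apply INR_S_neq_0.
Qed.

Lemma Cder_exp_coeff (z : C) : Cmod z < 1 ->
  Cder (CPS exp_coeff) z (CPS beta z * CPS exp_coeff z).
Proof.
intros Hz. eapply Cder_eq; [apply CPS_Cder; [apply disk_conv_exp_coeff | exact Hz]|].
eapply Cseries_unique.
- apply CPS_correct; [apply disk_conv_derive, disk_conv_exp_coeff | exact Hz].
- eapply Cseries_ext; [|apply CPS_mult; [apply disk_conv_beta | apply disk_conv_exp_coeff | exact Hz]].
  intros n. unfold CPS_derive. rewrite exp_coeff_S. field. apply INR_S_neq_0.
Qed.

(** Both sides satisfy y' = B y with y(0) = 1, B being the sum of the beta_n z^n. *)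
Lemma exp_primitive_series (z : C) : Cmod z < 1 ->
  CPS exp_coeff z = Cexp (CPS primitive_coeff z).
Proof.
intros Hz.
set (F := fun w => (CPS exp_coeff w * / Cexp (CPS primitive_coeff w))%C).
assert (HF : F z = F 0).
{ apply Cder_0_const; [|exact Hz]. intros w Hw. eapply Cder_eq.
  - apply Cder_mult; [apply Cder_exp_coeff, Hw|].
    apply Cder_inv; [apply Cexp_neq_0|].
    apply (Cder_comp (CPS primitive_coeff) Cexp); [apply Cder_primitive, Hw | apply Cder_Cexp].
  - cbv beta. field. apply Cexp_neq_0. }
unfold F in HF.
rewrite (CPS_0 exp_coeff), (CPS_0 primitive_coeff) in HF
  by (apply disk_conv_exp_coeff || apply disk_conv_primitive).
cbn [primitive_coeff] in HF. rewrite Cexp_0 in HF. change (exp_coeff 0) with (RtoC 1) in HF.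
replace (CPS exp_coeff z)
  with (CPS exp_coeff z * / Cexp (CPS primitive_coeff z) * Cexp (CPS primitive_coeff z))%C
  by (field; apply Cexp_neq_0).
rewrite HF. field.
Qed.

Lemma starlike_of_log_derivative (s : R) (omega : C -> C) : 0 < s <= 1 ->
  (forall z : C, Cmod z < 1 -> exists l, Cder omega z l) ->
  (forall z : C, Cmod z < 1 -> Cmod (omega z) < 1) -> omega 0 = 0 ->
  (forall z : C, Cmod z < 1 -> q_hpl s (omega z) = (1 + z * CPS beta z)%C) ->
  exists (f : C -> C) (a : nat -> C), class_ST_hpl s f /\ normalized_expansion f a /\
    a 2%nat = beta 0%nat /\ a 3%nat = ((beta 0%nat ^ 2 + beta 1%nat) / 2)%C.
Proof.
intros Hs Hhol Hdisk H0 Hq.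
set (Q := CPS primitive_coeff).
set (f := fun z => (z * Cexp (Q z))%C).
set (a := fun n => match n with 0%nat => RtoC 0 | S m => exp_coeff m end).
assert (Hder : forall z : C, Cmod z < 1 -> Cder f z (Cexp (Q z) * (1 + z * CPS beta z))).
{ intros z Hz. eapply Cder_eq.
  - apply Cder_mult; [apply Cder_id|].
    apply (Cder_comp Q Cexp); [apply Cder_primitive, Hz | apply Cder_Cexp].
  - cbv beta. ring. }
assert (Hexp : normalized_expansion f a).
{ split; [reflexivity | split; [reflexivity|]].
  intros z Hz. apply is_pseries_Cseries.
  replace (f z) with (a 0%nat * z ^ 0 + z * CPS exp_coeff z)%C.
  - apply (Cseries_shift (fun n => a n * z ^ n)%C).
    apply (Cseries_ext (fun n => z * (exp_coeff n * z ^ n))%C).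
    + intros n. simpl. ring.
    + apply Cseries_scal, CPS_correct; [apply disk_conv_exp_coeff | exact Hz].
  - rewrite exp_primitive_series by exact Hz. unfold f, Q. simpl. ring. }
exists f, a. split; [|split; [exact Hexp | split]].
- split; [split; [|split]|].
  + intros z Hz. eexists. apply Cder_is_derive, Hder, Hz.
  + apply (univalent_of_log_derivative Q (CPS beta)); [exact Cder_primitive|].
    intros z Hz. rewrite <- Hq by exact Hz. apply Re_q_hpl_pos, Hs.
  + exists a; exact Hexp.
  + exists omega. split; [|split; [exact Hdisk | split; [exact H0|]]].
    * intros z Hz. destruct (Hhol z Hz) as [l Hl]. exists l. apply Cder_is_derive, Hl.
    * intros z Hz. rewrite Hq by exact Hz. unfold zf'_over_f.
      destruct (Ceq_dec z 0) as [->|Hn]; [ring|].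
      rewrite (is_C_derive_unique f z _ (proj1 (Cder_is_derive _ _ _) (Hder z Hz))).
      unfold f. field. split; [apply Cexp_neq_0 | exact Hn].
- unfold a. rewrite exp_coeff_S, sum_O. simpl.
  unfold exp_coeff; simpl. field.
- unfold a. rewrite exp_coeff_S, sum_Sn, sum_O. simpl Nat.sub. rewrite exp_coeff_S, sum_O.
  unfold exp_coeff; simpl.
  change (@plus C_AbelianMonoid) with Cplus. replace (1 + 1) with 2 by ring.
  field.
Qed.
End ExpSeries.

(** * Extremal functions *)

(** The odd partial sums of u are the partial sums of v. *)
Lemma is_series_odd (u v : nat -> R) (l m : R) :
  (forall k, u (2 * k)%nat = 0) -> (forall k, u (S (2 * k)) = v k) ->
  is_series u l -> is_series v m -> l = m.
Proof.
intros Hev Hod Hu Hv.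
assert (E : forall n, sum_n u (S (2 * n)) = sum_n v n).
{ induction n as [|n IH].
  - change (2 * 0)%nat with 0%nat. rewrite sum_Sn, !sum_O.
    change (u 0%nat + u 1%nat = v 0%nat). rewrite <- (Hod 0%nat).
    change (u 0%nat) with (u (2 * 0)%nat). rewrite Hev. apply Rplus_0_l.
  - replace (S (2 * S n)) with (S (S (S (2 * n)))) by lia.
    rewrite sum_Sn, sum_Sn, IH, sum_Sn.
    replace (S (S (2 * n))) with (2 * S n)%nat by lia. rewrite Hod, Hev.
    change (sum_n v n + 0 + v (S n) = sum_n v n + v (S n)). ring. }
assert (L : is_lim_seq (fun n => sum_n u (S (2 * n))) l).
{ apply (is_lim_seq_subseq (sum_n u) l (fun n => S (2 * n))).
  - intros P [N HN]. exists N. intros n Hn. apply HN. lia.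
  - exact Hu. }
apply (is_lim_seq_ext _ (sum_n v)) in L; [|exact E].
apply is_lim_seq_unique in L. assert (L' : is_lim_seq (sum_n v) m) by exact Hv.
apply is_lim_seq_unique in L'. rewrite L in L'. injection L'. auto.
Qed.

(** The coefficients of z B(z^2) when b lists those of B. *)
Definition odd_spread (b : nat -> C) (n : nat) : C :=
  if Nat.even n then RtoC 0 else b (Nat.div2 n).

Lemma CPS_odd_spread (b : nat -> C) (z : C) : (forall n, Cmod (b n) <= 1) -> Cmod z < 1 ->
  CPS (odd_spread b) z = (z * CPS b (z * z))%C.
Proof.
intros Hb Hz.
assert (Hev : forall k, Nat.even (2 * k) = true) by (intros k; apply Nat.even_spec; exists k; lia).
assert (Hod : forall k, Nat.even (S (2 * k)) = false).
{ intros k. rewrite Nat.even_succ, <- Nat.negb_even, Hev. reflexivity. }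
assert (Hc : disk_conv (odd_spread b)).
{ apply disk_conv_bounded with 1. intros n; unfold odd_spread.
  destruct (Nat.even n); [rewrite Cmod_0; lra | apply Hb]. }
assert (Hzz : Cmod (z * z) < 1) by (rewrite Cmod_mult; pose proof (Cmod_ge_0 z); nra).
destruct (CPS_correct _ z Hc Hz) as [R1 I1].
destruct (Cseries_scal z _ _ (CPS_correct b (z * z) (disk_conv_bounded b 1 Hb) Hzz)) as [R2 I2].
assert (E0 : forall k, (odd_spread b (2 * k) * z ^ (2 * k))%C = 0).
{ intros k. unfold odd_spread. rewrite Hev. ring. }
assert (E1 : forall k, (odd_spread b (S (2 * k)) * z ^ (S (2 * k)))%C = (z * (b k * (z * z) ^ k))%C).
{ intros k. unfold odd_spread. rewrite Hod, Nat.div2_succ_double, Cpow_S, Cpow_mult_r.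
  replace (z ^ 2)%C with (z * z)%C by (simpl; ring). ring. }
apply Ceq_Re_Im.
- refine (is_series_odd _ _ _ _ _ _ R1 R2); intros k; cbv beta; [rewrite E0 | rewrite E1]; reflexivity.
- refine (is_series_odd _ _ _ _ _ _ I1 I2); intros k; cbv beta; [rewrite E0 | rewrite E1]; reflexivity.
Qed.

Lemma q_hpl_shift (s : R) (z : C) : 0 < s <= 1 -> Cmod z < 1 ->
  q_hpl s z = (1 + z * CPS (fun n => q_series s (S n)) z)%C.
Proof.
intros Hs Hz. rewrite q_hpl_series, CPS_shift by (try apply disk_conv_q_series; assumption).
reflexivity.
Qed.

Lemma q_series_1 (s : R) : q_series s 1 = RtoC s.
Proof. unfold q_series. f_equal. simpl. field. Qed.

(** The square z^2 serves as Schwarz function when |mu| <= 1, the identity otherwise. *)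
Lemma fekete_szego_attained (s lam : R) : 0 < s <= 1 ->
  exists (f : C -> C) (a : nat -> C), class_ST_hpl s f /\ normalized_expansion f a /\
    Cmod (a 3%nat - RtoC lam * a 2%nat ^ 2)
    = s / 2 * Rmax 1 (Rabs ((3 * s + 1) / 2 - 2 * s * lam)).
Proof.
intros Hs. set (mu := (3 * s + 1) / 2 - 2 * s * lam).
set (b := fun n => q_series s (S n)).
assert (Hb : forall n, Cmod (b n) <= 1) by (intros n; apply Cmod_q_series, Hs).
destruct (Rle_or_lt (Rabs mu) 1) as [Hmu|Hmu].
- destruct (starlike_of_log_derivative (odd_spread b)) with (s := s) (omega := fun z : C => (z * z)%C)
    as [f [a [Hf [Ha [A2 A3]]]]].
  + intros n; unfold odd_spread. destruct (Nat.even n); [rewrite Cmod_0; lra | apply Hb].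
  + exact Hs.
  + intros z _. eexists. apply Cder_mult; apply Cder_id.
  + intros z Hz. rewrite Cmod_mult. pose proof (Cmod_ge_0 z). nra.
  + ring.
  + intros z Hz. rewrite q_hpl_shift, CPS_odd_spread by
      (try assumption; rewrite Cmod_mult; pose proof (Cmod_ge_0 z); nra).
    unfold b. ring.
  + exists f, a. split; [exact Hf | split; [exact Ha|]]. rewrite A2, A3.
    change (odd_spread b 0) with (RtoC 0). change (odd_spread b 1) with (q_series s 1).
    rewrite q_series_1, Rmax_left by exact Hmu.
    replace ((0 ^ 2 + RtoC s) / 2 - RtoC lam * 0 ^ 2)%C with (RtoC (s / 2)).
    * rewrite Cmod_R, Rabs_pos_eq; lra.
    * rewrite RtoC_div by lra. simpl. field.
- destruct (starlike_of_log_derivative b Hb s (fun z => z) Hs) as [f [a [Hf [Ha [A2 A3]]]]].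
  + intros z _. eexists. apply Cder_id.
  + auto.
  + reflexivity.
  + intros z Hz. apply q_hpl_shift; assumption.
  + exists f, a. split; [exact Hf | split; [exact Ha|]]. rewrite A2, A3.
    assert (E1 : b 0%nat = RtoC s) by apply q_series_1.
    assert (E2 : b 1%nat = RtoC (s * (s + 1) / 2)).
    { unfold b, q_series. f_equal. simpl. field. }
    rewrite E1, E2, Rmax_right by lra.
    replace ((RtoC s ^ 2 + RtoC (s * (s + 1) / 2)) / 2 - RtoC lam * RtoC s ^ 2)%C
      with (RtoC (s / 2 * mu)).
    * rewrite Cmod_R, Rabs_mult, (Rabs_pos_eq (s / 2)) by lra. reflexivity.
    * unfold mu.
      replace (s / 2 * ((3 * s + 1) / 2 - 2 * s * lam))
        with ((s * s + s * (s + 1) / 2) / 2 - lam * (s * s)) by field.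
      rewrite RtoC_minus, RtoC_div, RtoC_plus, !RtoC_mult by lra. simpl. field.
Qed.

Lemma fekete_szego_cases (s lam : R) : 0 < s <= 1 ->
  let M := s / 2 * Rmax 1 (Rabs ((3 * s + 1) / 2 - 2 * s * lam)) in
  (lam >= (3 * s + 3) / (4 * s) -> M = s ^ 2 * (lam - (3 * s + 1) / (4 * s))) /\
  ((3 * s - 1) / (4 * s) <= lam <= (3 * s + 3) / (4 * s) -> M = s / 2) /\
  (lam <= (3 * s - 1) / (4 * s) -> M = - s ^ 2 * (lam - (3 * s + 1) / (4 * s))).
Proof.
intros Hs M. unfold M. set (mu := (3 * s + 1) / 2 - 2 * s * lam).
assert (Hc : forall c, lam - c / (4 * s) = (4 * s * lam - c) / (4 * s)) by (intros; field; lra).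
assert (Hup : forall c, lam <= c / (4 * s) -> 4 * s * lam <= c).
{ intros c H. apply (Rmult_le_compat_l (4 * s)) in H; [|lra].
  replace (4 * s * (c / (4 * s))) with c in H by (field; lra). exact H. }
assert (Hlo : forall c, c / (4 * s) <= lam -> c <= 4 * s * lam).
{ intros c H. apply (Rmult_le_compat_l (4 * s)) in H; [|lra].
  replace (4 * s * (c / (4 * s))) with c in H by (field; lra). exact H. }
split; [|split].
- intros H. apply Rge_le, Hlo in H.
  rewrite Rabs_left1, Rmax_right by (unfold mu; lra). unfold mu. field. lra.
- intros [H1 H2]. apply Hlo in H1. apply Hup in H2.
  rewrite Rmax_left by (unfold mu; apply Rabs_le; lra). ring.
- intros H. apply Hup in H.
  rewrite Rabs_pos_eq, Rmax_right by (unfold mu; lra). unfold mu. field. lra.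
Qed.

Theorem theorem3p6 : forall s lam : R, 0 < s <= 1 ->
  (forall (f : C -> C) (a : nat -> C),
     class_ST_hpl s f -> normalized_expansion f a ->
     (lam >= (3 * s + 3) / (4 * s) ->
        Cmod (a 3%nat - RtoC lam * a 2%nat ^ 2)%C
        <= s ^ 2 * (lam - (3 * s + 1) / (4 * s))) /\
     ((3 * s - 1) / (4 * s) <= lam <= (3 * s + 3) / (4 * s) ->
        Cmod (a 3%nat - RtoC lam * a 2%nat ^ 2)%C <= s / 2) /\
     (lam <= (3 * s - 1) / (4 * s) ->
        Cmod (a 3%nat - RtoC lam * a 2%nat ^ 2)%C
        <= - s ^ 2 * (lam - (3 * s + 1) / (4 * s)))) /\
  (exists (f : C -> C) (a : nat -> C),
     class_ST_hpl s f /\ normalized_expansion f a /\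
     (lam >= (3 * s + 3) / (4 * s) ->
        Cmod (a 3%nat - RtoC lam * a 2%nat ^ 2)%C
        = s ^ 2 * (lam - (3 * s + 1) / (4 * s))) /\
     ((3 * s - 1) / (4 * s) <= lam <= (3 * s + 3) / (4 * s) ->
        Cmod (a 3%nat - RtoC lam * a 2%nat ^ 2)%C = s / 2) /\
     (lam <= (3 * s - 1) / (4 * s) ->
        Cmod (a 3%nat - RtoC lam * a 2%nat ^ 2)%C
        = - s ^ 2 * (lam - (3 * s + 1) / (4 * s)))).
Proof.
intros s lam Hs. destruct (fekete_szego_cases s lam Hs) as [C1 [C2 C3]]. split.
- intros f a Hf Ha. pose proof (fekete_szego_bound s lam f a Hs Hf Ha) as H.
  split; [|split]; intros Hl; [rewrite <- C1 | rewrite <- C2 | rewrite <- C3]; assumption.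
- destruct (fekete_szego_attained s lam Hs) as [f [a [Hf [Ha E]]]].
  exists f, a. rewrite E. auto.
Qed.
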